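(* Let $\Pi_1,\Pi_2,\Pi_3$ be planar networks of rank $n$ such that each $\Pi_i$ has an $n$-multipath, and let $w_i\in\mathbb T^{\Pi_i}$, $i=1,2,3$, be such that $(\Pi_i,w_i)$ for $i=1,2,3$, $(\Pi_1\circ\Pi_2,w_1\circ w_2)$, $(\Pi_2\circ\Pi_3,w_2\circ w_3)$ and $(\Pi_1\circ\Pi_2\circ\Pi_3,w_1\circ w_2\circ w_3)$ satisfy the multi-Gelfand-Zeitlin condition. Then the values $m_{i,j,k}=m_{i,j,k}(w_1,w_2,w_3)$ satisfy, for all integers $i,j,k\ge0$ with $i+j+k\le n-2$, $$m_{i,j+1,k}+m_{i+1,j,k+1}=\max\{m_{i+1,j,k}+m_{i,j+1,k+1},\ m_{i,j,k+1}+m_{i+1,j+1,k}\}.$$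
   Context: **Planar networks.** $\mathbb T=\mathbb R\cup\{-\infty\}$. A planar network of rank $n$ is a finite planar graph embedded in a strip $0\le x\le r$ with no vertical edges, oriented from left to right, with $n$ sources on $x=0$ and $n$ sinks on $x=r$, each labelled $1,\dots,n$ from bottom to top. A weighting is a map $w$ from edges to $\mathbb T$; $\mathbb T^\Pi$ is the set of weightings. Concatenation $\Pi_1\circ\Pi_2$ glues the $i$-th sink of $\Pi_1$ to the $i$-th source of $\Pi_2$; $w_1\circ w_2$ is the induced weighting. An $a$-multipath in $\Pi$ is a collection of $a$ pairwise vertex-disjoint oriented paths from sources to sinks. For $\underline\alpha=(\alpha_1,\dots,\alpha_k)\in\mathbb Z_{\ge0}^k$, an $\underline\alpha$-multipath in $\Pi_1\circ\dots\circ\Pi_k$ is a tuple $(p_1,\dots,p_k)$ of pairwise vertex-disjoint multipaths, $p_i$ being an $\alpha_i$-multipath in $\Pi_1\circ\dots\circ\Pi_i$ (starting at sources of $\Pi_1$ and ending at sinks of $\Pi_i$). Its weight is the sum of the weights of all its edges. **The function $m$.** For $\underline\alpha\in\mathbb Z_{\ge0}^3$ with $\alpha_1+\alpha_2+\alpha_3\le n$, $m_{\underline\alpha}(w_1,w_2,w_3)$ is the maximal weight of an $\underline\alpha$-multipath in $\Pi_1\circ\Pi_2\circ\Pi_3$ ($-\infty$ if there is none), with $m_{0,0,0}=0$. **Multi-Gelfand-Zeitlin condition.** A weighting of a composite network $\Pi_1\circ\dots\circ\Pi_k$ satisfies it if for every $\underline\alpha\in\mathbb Z_{\ge0}^k$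 with $\sum\alpha_i\le n$ there is an $\underline\alpha$-multipath of maximal weight (among all $\underline\alpha$-multipaths) whose set of sources is $\{n-\sum\alpha_i+1,\dots,n\}$ and such that the set of sinks of $p_i$ is $\{1,\dots,\alpha_i\}$ for each $i$ (for a single network take $k=1$). *)

(* Defs.v *)
From HB Require Import structures.
From mathcomp Require Import all_boot all_order all_algebra.
From mathcomp Require Import all_classical all_reals all_analysis.

Set Implicit Arguments.
Unset Strict Implicit.
Unset Printing Implicit Defensive.

Import Order.TTheory GRing.Theory Num.Theory.
Import numFieldNormedType.Exports.

Local Open Scope classical_set_scope.
Local Open Scope ring_scope.

(* The combinatorial part of a planar network of rank n: a finite directed
   (multi)graph with n labelled sources and n labelled sinks.  The label l of
   the literature, 1 <= l <= n, is the ordinal l - 1. *)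
Record network (n : nat) := Network {
  vertex : finType;
  edge : finType;
  tail : edge -> vertex;
  head : edge -> vertex;
  source : 'I_n -> vertex;
  sink : 'I_n -> vertex;
  source_inj : injective source;
  sink_inj : injective sink }.

(* An embedding of a network in the strip 0 <= x <= width.  An edge with no
   vertical part that runs from left to right is the graph of a continuous
   function on the interval between the abscissas of its endpoints; values of
   [curve e] outside that interval are irrelevant. *)
Record strip_embedding (R : realType) (n : nat) (N : network n) :=
  StripEmbedding {
  width : R;
  xpos : vertex N -> R;
  ypos : vertex N -> R;
  curve : edge N -> R -> R;
  width_gt0 : 0 < width;
  xpos_strip : forall v, 0 <= xpos v <= width;
  pos_inj : forall u v, xpos u = xpos v -> ypos u = ypos v -> u = v;
  xpos_eq0 : forall v, xpos v = 0 <-> exists i, v = source N i;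
  xpos_eq_width : forall v, xpos v = width <-> exists i, v = sink N i;
  ypos_source : forall i j : 'I_n, (i < j)%N ->
    ypos (source N i) < ypos (source N j);
  ypos_sink : forall i j : 'I_n, (i < j)%N ->
    ypos (sink N i) < ypos (sink N j);
  edge_rightward : forall e, xpos (tail e) < xpos (head e);
  curve_continuous : forall e,
    {within `[xpos (tail e), xpos (head e)], continuous (curve e)};
  curve_tail : forall e, curve e (xpos (tail e)) = ypos (tail e);
  curve_head : forall e, curve e (xpos (head e)) = ypos (head e);
  edge_avoids_vertices : forall e v,
    xpos (tail e) < xpos v < xpos (head e) -> curve e (xpos v) <> ypos v;
  edges_do_not_cross : forall e f x, e <> f ->
    xpos (tail e) < x < xpos (head e) -> xpos (tail f) < x < xpos (head f) ->
    curve e x <> curve f x }.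

Record planar_network (R : realType) (n : nat) := PlanarNetwork {
  planar_net :> network n;
  planar_embedding : strip_embedding R planar_net }.

Section Concatenation.
Variables (n : nat) (N1 N2 : network n).

Definition concat_vertex : finType :=
  (vertex N1 + {v : vertex N2 | v \notin codom (source N2)})%type.

(* The image in the concatenation of a vertex of N2: the i-th source of N2
   becomes the i-th sink of N1. *)
Definition glue (v : vertex N2) : concat_vertex :=
  match boolP (v \in codom (source N2)) with
  | AltTrue v_source => inl (sink N1 (iinv v_source))
  | AltFalse v_inner => inr (exist _ v v_inner)
  end.

Lemma glue_source i : glue (source N2 i) = inl (sink N1 i).
Proof.
rewrite /glue; destruct (boolP _) as [v_source|v_inner].
  by congr (inl (sink N1 _)); apply: (@source_inj n N2); rewrite f_iinv.
by exfalso; move: v_inner; rewrite codom_f.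
Qed.

Lemma glue_inner v (v_inner : v \notin codom (source N2)) :
  glue v = inr (exist _ v v_inner).
Proof.
rewrite /glue; destruct (boolP _) as [v_source|v_inner'].
  by exfalso; move: v_inner; rewrite v_source.
by congr inr; apply: val_inj.
Qed.

Lemma glue_inj : injective glue.
Proof.
move=> u v; case: (boolP (u \in codom (source N2))) => [/codomP[i ->]|hu];
  case: (boolP (v \in codom (source N2))) => [/codomP[j ->]|hv];
  rewrite ?glue_source ?(glue_inner hu) ?(glue_inner hv) //.
  by case=> /sink_inj ->.
by case.
Qed.

Definition concat_tail (e : edge N1 + edge N2) : concat_vertex :=
  match e with inl e1 => inl (tail e1) | inr e2 => glue (tail e2) end.

Definition concat_head (e : edge N1 + edge N2) : concat_vertex :=
  match e with inl e1 => inl (head e1) | inr e2 => glue (head e2) end.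

Lemma concat_source_inj :
  injective (fun i : 'I_n => inl (source N1 i) : concat_vertex).
Proof. by move=> i j [] /source_inj. Qed.

Lemma concat_sink_inj : injective (fun i : 'I_n => glue (sink N2 i)).
Proof. by move=> i j /glue_inj /sink_inj. Qed.

Definition concat : network n :=
  Network (edge := (edge N1 + edge N2)%type) concat_tail concat_head
    concat_source_inj concat_sink_inj.

End Concatenation.

(* Weightings with values in \bar R deprived of +oo. *)
Record weighting (R : realType) (n : nat) (N : network n) := Weighting {
  weight :> edge N -> \bar R;
  weight_neq_pinfty : forall e, weight e <> +oo%E }.

Section ConcatWeighting.
Variables (R : realType) (n : nat) (N1 N2 : network n).
Variables (w1 : weighting R N1) (w2 : weighting R N2).

Definition concat_weight (e : edge (concat N1 N2)) : \bar R :=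
  match e with inl e1 => w1 e1 | inr e2 => w2 e2 end.

Lemma concat_weight_neq_pinfty e : concat_weight e <> +oo%E.
Proof. by case: e => e; apply: weight_neq_pinfty. Qed.

Definition concat_weighting : weighting R (concat N1 N2) :=
  Weighting concat_weight_neq_pinfty.

End ConcatWeighting.

Section Multipaths.
Variables (n : nat) (N : network n).

(* A path is given by its first vertex and the list of its edges. *)
Definition route : Type := (vertex N * seq (edge N))%type.

Fixpoint walk (v : vertex N) (es : seq (edge N)) : bool :=
  if es is e :: es' then (tail e == v) && walk (head e) es' else true.

Definition route_vertices (p : route) : seq (vertex N) :=
  p.1 :: map (@head n N) p.2.

Definition route_end (p : route) : vertex N := last p.1 (map (@head n N) p.2).

Definition source_to_sink (p : route) : bool :=
  [&& walk p.1 p.2, p.1 \in codom (source N)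
    & route_end p \in codom (sink N)].

Definition vertex_disjoint (p q : route) : bool :=
  [disjoint route_vertices p & route_vertices q].

Definition is_multipath (a : nat) (ps : seq route) : bool :=
  [&& size ps == a, all source_to_sink ps & pairwise vertex_disjoint ps].

Definition source_set (ps : seq route) : {set 'I_n} :=
  [set i | source N i \in map fst ps]%SET.

Definition sink_set (ps : seq route) : {set 'I_n} :=
  [set i | sink N i \in map route_end ps]%SET.

End Multipaths.

Definition lift_route (n : nat) (N1 N2 : network n) (p : route N1) :
    route (concat N1 N2) :=
  (inl p.1, map inl p.2).

(* A composite network together with its decomposition: [Then C N] stands for
   the concatenation (Pi_1 o ... o Pi_k) o N when C stands for
   Pi_1 o ... o Pi_k. *)
Inductive composite (n : nat) :=
| Single of network n
| Then of composite n & network n.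

Fixpoint factors (n : nat) (C : composite n) : nat :=
  match C with Single _ => 1 | Then C' _ => (factors C').+1 end.

Fixpoint total (n : nat) (C : composite n) : network n :=
  match C with Single N => N | Then C' N => concat (total C') N end.

(* The candidate tuples (p_1, ..., p_k), nested to the left; p_i is a list of
   paths in Pi_1 o ... o Pi_i. *)
Fixpoint path_tuple (n : nat) (C : composite n) : Type :=
  match C with
  | Single N => seq (route N)
  | Then C' N => (path_tuple C' * seq (route (concat (total C') N)))%type
  end.

(* All the paths of p_1, ..., p_k, seen in Pi_1 o ... o Pi_k. *)
Fixpoint routes (n : nat) (C : composite n) :
    path_tuple C -> seq (route (total C)) :=
  match C return path_tuple C -> seq (route (total C)) with
  | Single N => fun ps => ps
  | Then C' N => fun P => map (lift_route N) (routes P.1) ++ P.2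
  end.

(* In the definitions below alpha = (alpha_1, ..., alpha_k) is meant to have
   size [factors C]; alpha_i is [nth 0 alpha i.-1]. *)
Fixpoint is_multimultipath (n : nat) (C : composite n) (alpha : seq nat) :
    path_tuple C -> Prop :=
  match C return path_tuple C -> Prop with
  | Single N => fun ps => is_multipath (nth 0%N alpha 0) ps
  | Then C' N => fun P =>
      [/\ is_multimultipath alpha P.1,
          is_multipath (nth 0%N alpha (factors C')) P.2 &
          pairwise (@vertex_disjoint n (concat (total C') N))
            (@routes n (Then C' N) P)]
  end.

(* For each i, the set of sinks (in Pi_1 o ... o Pi_i) of p_i consists of the
   lowest alpha_i ones. *)
Fixpoint bottom_sinks (n : nat) (C : composite n) (alpha : seq nat) :
    path_tuple C -> Prop :=
  match C return path_tuple C -> Prop with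
  | Single N => fun ps =>
      sink_set ps = [set i : 'I_n | (i < nth 0%N alpha 0)%N]%SET
  | Then C' N => fun P =>
      bottom_sinks alpha P.1 /\
      sink_set P.2 = [set i : 'I_n | (i < nth 0%N alpha (factors C'))%N]%SET
  end.

Section Maxima.
Variables (R : realType) (n : nat) (C : composite n).
Variable w : weighting R (total C).

Definition tuple_weight (P : path_tuple C) : \bar R :=
  (\sum_(p <- routes P) \sum_(e <- p.2) w e)%E.

(* The networks in use are acyclic, so that this is the supremum of a finite
   set, i.e. a maximum, or -oo if there is no alpha-multipath. *)
Definition max_weight (alpha : seq nat) : \bar R :=
  ereal_sup [set tuple_weight P | P in @is_multimultipath n C alpha].

Definition multi_GZ : Prop :=
  forall alpha : seq nat, size alpha = factors C -> (sumn alpha <= n)%N ->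
  exists P : path_tuple C,
    [/\ is_multimultipath alpha P,
        forall Q : path_tuple C, is_multimultipath alpha Q ->
          (tuple_weight Q <= tuple_weight P)%E,
        source_set (routes P) = [set i : 'I_n | (n - sumn alpha <= i)%N]%SET &
        bottom_sinks alpha P].

End Maxima.

(* Main.v *)
Require Import Defs.
From mathcomp Require Import all_boot all_order all_algebra.
From mathcomp Require Import all_classical all_reals all_analysis.
From mathcomp Require Import zify lra finset.
Import Defs Order.TTheory.

(** Multipaths are encoded as flows: sets of edges whose in- and out-degrees
    balance, up to prescribed sources and terminals, with at most one path
    through each vertex. Put [X = m_(i,j+1,k) + m_(i+1,j,k+1)],
    [Y = m_(i+1,j,k) + m_(i,j+1,k+1)] and [Z = m_(i,j,k+1) + m_(i+1,j+1,k)].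
    By the Gelfand-Zeitlin condition each value is attained by a flow from the
    top sources to the bottom sinks, so that the two flows in each of the sums
    have all sources but one in common.

    Superposing the two flows of [X] (resp. of [Y]) and exchanging them along
    the alternating trail that starts at the additional source moves this source
    and one terminal from one flow to the other; the possible terminals give
    [X <= max(Y, Z)] (resp. [Y <= max(X, Z)]). Planarity is not used here.

    For [Z <= X], list the paths of either flow from top to bottom and replace
    the [t]-th paths by their lower and upper envelopes, in each of the three
    strips. In terms of the number of paths above a point, the envelopes are the
    minimum and the maximum of the two counts, and an edge belongs to an
    envelope iff this minimum (resp. maximum) jumps there. *)

Set Implicit Arguments.
Unset Strict Implicit.
Unset Printing Implicit Defensive.

(** * Flows and their exchange *)

(** Exchange alone is symmetric in X, Y and Z: it would bound each of the sums by the maximum of the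
    other two, so that it only says that the largest value occurs twice. Planarity singles out X
    through Z <= X, and this inequality also turns Y <= max(X, Z) into Y <= X. A flow forgets how
    its edges are joined into paths, so an exchange or an envelope is checked vertex by vertex. The
    envelopes are taken strip by strip because counting the paths above a point requires paths that
    span the whole strip, whereas in the composite network some paths stop at an inner wall. Where
    the flows cross these walls is unknown, but the envelopes of the crossing labels are the same
    seen from either side, so the pieces can be glued again. Which envelope receives which bottom
    exits depends only on the numbers of paths that continue: these agree at the first wall and
    differ by one at the second. This is why the additional exit goes to the flow with more paths at
    the first wall, and to the other flow at the second. *)

Section Flow.
Variables (n : nat) (N : network n).
Implicit Types (F : {set edge N}) (S T : {set vertex N}) (v : vertex N).

Definition indeg F v := #|[set e in F | head e == v]|.
Definition outdeg F v := #|[set e in F | tail e == v]|.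
Definition visits F S v := indeg F v + (v \in S).

(** A vertex in both [S] and [T] is a path without edges. Closed circuits are allowed here; they are
    ruled out later by a rank function on the vertices. *)
Definition flow F S T := forall v,
  (visits F S v = outdeg F v + (v \in T)) /\ (visits F S v <= 1).

Lemma indeg_gt0 F v : reflect (exists2 e, e \in F & head e = v) (0 < indeg F v).
Proof.
apply: (iffP card_gt0P) => [[e]|[e eF <-]].
  by rewrite inE => /andP[eF /eqP <-]; exists e.
by exists e; rewrite inE eF eqxx.
Qed.

Lemma outdeg_gt0 F v : reflect (exists2 e, e \in F & tail e = v) (0 < outdeg F v).
Proof.
apply: (iffP card_gt0P) => [[e]|[e eF <-]].
  by rewrite inE => /andP[eF /eqP <-]; exists e.
by exists e; rewrite inE eF eqxx.
Qed.

Lemma indegE F v : indeg F v = \sum_(e | head e == v) (e \in F).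
Proof.
rewrite /indeg -sum1_card (eq_bigl (fun e => (head e == v) && (e \in F))) ?big_mkcondr /=.
  by apply: eq_bigr => e _; case: (e \in F).
by move=> e; rewrite inE andbC.
Qed.

Lemma outdegE F v : outdeg F v = \sum_(e | tail e == v) (e \in F).
Proof.
rewrite /outdeg -sum1_card (eq_bigl (fun e => (tail e == v) && (e \in F))) ?big_mkcondr /=.
  by apply: eq_bigr => e _; case: (e \in F).
by move=> e; rewrite inE andbC.
Qed.

Lemma flow_head_inj F S T : flow F S T -> {in F &, injective (@head n N)}.
Proof.
move=> fl e f eF fF ef; have [_] := fl (head e).
rewrite /visits => h; have : indeg F (head e) <= 1 by lia.
by move=> /card_le1_eqP; apply; rewrite inE ?eF ?fF ?ef eqxx.
Qed.

Lemma flow_tail_inj F S T : flow F S T -> {in F &, injective (@tail n N)}.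
Proof.
move=> fl e f eF fF ef; have [h1 h2] := fl (tail e).
have : outdeg F (tail e) <= 1 by lia.
by move=> /card_le1_eqP; apply; rewrite inE ?eF ?fF ?ef eqxx.
Qed.

Lemma flow_card F S T : flow F S T -> #|S| = #|T|.
Proof.
move=> fl.
have sum_deg (g : edge N -> vertex N) :
    \sum_v #|[set e in F | g e == v]| = #|F|.
  rewrite -sum1_card (partition_big g xpredT) //=.
  by apply: eq_bigr => v _; rewrite -sum1dep_card.
have : \sum_v visits F S v = \sum_v (outdeg F v + (v \in T)).
  by apply: eq_bigr => v _; have [] := fl v.
rewrite !big_split /= /indeg /outdeg !sum_deg => /addnI.
have card (U : {set vertex N}) : \sum_v (v \in U) = #|U| :> nat.
  by rewrite -sum1_card [RHS]big_mkcond /=; apply: eq_bigr => v _; case: (v \in U).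
by rewrite !card.
Qed.

(* A flow is encoded by the bijection from the complement of [T] to the
   complement of [S] that moves along the flow and fixes the unvisited
   vertices. *)
Definition arc F S u v :=
  [exists e in F, (tail e == u) && (head e == v)] || (u == v) && (visits F S u == 0).

Lemma arcP F S u v : reflect
  ((exists2 e, e \in F & tail e = u /\ head e = v) \/ u = v /\ visits F S u = 0)
  (arc F S u v).
Proof.
apply: (iffP orP) => [[/exists_inP[e eF /andP[/eqP tu /eqP hv]]|/andP[/eqP-> /eqP]]|].
- by left; exists e.
- by right.
- case=> [[e eF [<- <-]]|[-> ->]].
    by left; apply/exists_inP; exists e; rewrite ?eqxx.
  by right; rewrite !eqxx.
Qed.

Section Arc.
Variables (F : {set edge N}) (S T : {set vertex N}) (fl : flow F S T).

Lemma arc_notS u v : arc F S u v -> v \notin S.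
Proof.
move=> /arcP[[e eF [_ hv]]|[<- v0]].
  have [_] := fl v; rewrite /visits.
  have : 0 < indeg F v by apply/indeg_gt0; exists e.
  by case: (v \in S); lia.
by move: v0; rewrite /visits; case: (u \in S); lia.
Qed.

Lemma arc_notT u v : arc F S u v -> u \notin T.
Proof.
have [h1 h2] := fl u.
move=> /arcP[[e eF [tu _]]|[_ u0]].
  have : 0 < outdeg F u by apply/outdeg_gt0; exists e.
  by case: (u \in T) h1 h2 => //; lia.
by case: (u \in T) h1 => //; lia.
Qed.

Lemma arc_into v : v \notin S -> exists u, arc F S u v.
Proof.
move=> vS; have [v0|/indeg_gt0[e eF hv]] := posnP (indeg F v).
  by exists v; apply/arcP; right; rewrite /visits (negPf vS) v0.
by exists (tail e); apply/arcP; left; exists e.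
Qed.

Lemma arc_from u : u \notin T -> exists v, arc F S u v.
Proof.
move=> uT; have [h1 h2] := fl u; rewrite (negPf uT) addn0 in h1.
have [u0|/outdeg_gt0[e eF tu]] := posnP (outdeg F u).
  by exists u; apply/arcP; right; rewrite h1.
by exists (head e); apply/arcP; left; exists e.
Qed.

Lemma arc_visits_head e : e \in F -> visits F S (head e) = 1.
Proof.
move=> eF; have [_] := fl (head e); rewrite /visits.
have : 0 < indeg F (head e) by apply/indeg_gt0; exists e.
lia.
Qed.

Lemma arc_visits_tail e : e \in F -> visits F S (tail e) = 1.
Proof.
move=> eF; have [] := fl (tail e).
have : 0 < outdeg F (tail e) by apply/outdeg_gt0; exists e.
lia.
Qed.

Lemma arc_fun u v v' : arc F S u v -> arc F S u v' -> v = v'.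
Proof.
move=> /arcP[[e eF [tu hv]]|[uv u0]] /arcP[[f fF [tu' hv']]|[uv' u0']].
- by rewrite -hv -hv' (flow_tail_inj fl eF fF) // tu tu'.
- by move: u0'; rewrite -tu (arc_visits_tail eF).
- by move: u0; rewrite -tu' (arc_visits_tail fF).
- by rewrite -uv -uv'.
Qed.

Lemma arc_inj u u' v : arc F S u v -> arc F S u' v -> u = u'.
Proof.
move=> /arcP[[e eF [tu hv]]|[uv u0]] /arcP[[f fF [tu' hv']]|[uv' u0']].
- by rewrite -tu -tu' (flow_head_inj fl eF fF) // hv hv'.
- by move: u0'; rewrite uv' -hv (arc_visits_head eF).
- by move: u0; rewrite uv -hv' (arc_visits_head fF).
- by rewrite uv uv'.
Qed.

Lemma arc_loop v : visits F S v = 0 -> arc F S v v.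
Proof. by move=> v0; apply/arcP; right. Qed.

End Arc.

(* Exchange along the alternating trail [K] that starts at the new source [s],
   runs forward along [F'] and backward along [F]: each step leaves [u] by the
   arc of [F'] and goes back from its end by the arc of [F]. The trail is an
   orbit of a partial injection, so that it leaves the domain of this injection
   (the complement of [T']) exactly once. *)
Lemma flow_exchange F F' S T T' s :
    s \notin S -> flow F S T -> flow F' (s |: S) T' ->
  exists t A B, [/\ t \in T' :\: T, flow A (s |: S) (t |: T),
    flow B S (T' :\ t) &
    forall e, (e \in A) + (e \in B) = (e \in F) + (e \in F')].
Proof.
move=> sS fl fl'.
have [v0 v0s] := arc_into F sS.
pose step u u' := [exists v, arc F' (s |: S) u v && arc F S u' v].
have stepP u u' : reflect (exists2 v, arc F' (s |: S) u v & arc F S u' v) (step u u').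
  by apply: (iffP existsP) => [[v /andP[]]|[v a b]]; exists v => //; apply/andP.
have step_fun u v w : step u v -> step u w -> v = w.
  move=> /stepP[x ux vx] /stepP[y uy wy].
  by rewrite (arc_fun fl' uy ux) in wy; apply: (arc_inj fl vx wy).
have step_inj u v w : step u w -> step v w -> u = v.
  move=> /stepP[x ux vx] /stepP[y uy wy].
  by rewrite (arc_fun fl wy vx) in uy; apply: (arc_inj fl' ux uy).
have no_step u : ~~ step u v0.
  apply/negP => /stepP[v uv v0v]; have := arc_notS fl' uv.
  by rewrite (arc_fun fl v0v v0s) setU11.
have step_from u : u \notin T' -> exists u', step u u'.
  move=> /(arc_from fl')[v uv]; have := arc_notS fl' uv.
  rewrite in_setU1 negb_or => /andP[_ /(arc_into F)[u' u'v]].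
  by exists u'; apply/stepP; exists v.
have step_notT' u u' : step u u' -> u \notin T'.
  by move=> /stepP[v uv _]; apply: (arc_notT fl' uv).
pose K : {set vertex N} := [set u | connect step v0 u].
have v0K : v0 \in K by rewrite inE connect0.
have stepK u u' : u \in K -> step u u' -> u' \in K.
  by rewrite !inE => h /connect1; apply: connect_trans.
have Kstep u' : u' \in K -> u' = v0 \/ exists2 u, u \in K & step u u'.
  rewrite inE => /connectP[p]; case/lastP: p => [_ ->|p x]; first by left.
  rewrite rcons_path last_rcons => /andP[pp px] ->; right.
  by exists (last v0 p) => //; rewrite inE; apply/connectP; exists p.
clearbody K.
have KT u : u \in K -> u \notin T.
  move=> /Kstep[->|[u' _ /stepP[v _ uv]]]; first exact: (arc_notT fl v0s).
  exact: (arc_notT fl uv).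
pose next u := odflt v0 [pick u' | step u u'].
have nextP u : u \notin T' -> step u (next u).
  by move=> /step_from[u' uu']; rewrite /next; case: pickP => [//|/(_ u')]; rewrite uu'.
have Knext : K = v0 |: next @: (K :\: T').
  apply/setP => u; rewrite in_setU1; apply/idP/orP => [/Kstep[->|[u' u'K u'u]]|].
  - by rewrite eqxx; left.
  - right; apply/imsetP; exists u'; first by rewrite inE (step_notT' _ _ u'u).
    by apply: (step_fun u') u'u (nextP _ (step_notT' _ _ u'u)).
  - case=> [/eqP-> //|/imsetP[u' /setDP[u'K u'T'] ->]].
    exact: stepK u'K (nextP _ u'T').
(* [next] maps the points of [K] outside [T'] injectively onto [K] without [v0], so exactly one
   point of [K] lies in [T']. Counting replaces following the trail to its end. *)
have cardK : #|K :&: T'| = 1.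
  have : #|K| = (#|K :\: T'|).+1.
    rewrite {1}Knext cardsU1 card_in_imset ?add1n.
      suff -> : v0 \notin next @: (K :\: T') by [].
      apply/imsetP => -[u /setDP[_ uT'] v0u].
      by have := no_step u; rewrite v0u nextP.
    move=> u u' /setDP[_ uT'] /setDP[_ u'T'] uu'.
    by apply: (step_inj u u' (next u)); rewrite ?nextP // uu' nextP.
  by rewrite -(cardsID T' K); lia.
have /cards1P[t Kt] : #|K :&: T'| == 1 by rewrite cardK.
have [tK tT'] : t \in K /\ t \in T' by apply/setIP; rewrite Kt set11.
have KT' u : u \in K -> (u \in T') = (u == t).
  by move=> uK; have /setP/(_ u) := Kt; rewrite in_setI in_set1 uK.
pose A := [set e | if tail e \in K then e \in F' else e \in F].
pose B := [set e | if tail e \in K then e \in F else e \in F'].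
(* [R] is the set of ends of the arcs that leave [K], either in [F] or in [F']
   (where [s] is to be added). *)
pose R v := [exists u in K, arc F S u v].
have RP v : reflect (exists2 u, u \in K & arc F S u v) (R v).
  by apply: (iffP exists_inP).
have RF u v : arc F S u v -> (u \in K) = R v.
  move=> uv; apply/idP/RP => [uK|[u' u'K u'v]]; first by exists u.
  by rewrite (arc_inj fl uv u'v).
have RF' u v : arc F' (s |: S) u v -> (u \in K) = R v.
  move=> uv; have := arc_notS fl' uv; rewrite in_setU1 negb_or => /andP[vs vS].
  have [u' u'v] := arc_into F vS.
  have uu' : step u u' by apply/stepP; exists v.
  rewrite -(RF _ _ u'v); apply/idP/idP => [uK|]; first exact: stepK uK uu'.
  move=> /Kstep[u'v0|[u'' u''K u''u']].
    by case/negP: (no_step u); rewrite -u'v0.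
  by rewrite (step_inj _ _ _ uu' u''u').
have Rs : R s by apply/RP; exists v0.
have arcF e : e \in F -> arc F S (tail e) (head e).
  by move=> eF; apply/arcP; left; exists e.
have arcF' e : e \in F' -> arc F' (s |: S) (tail e) (head e).
  by move=> eF'; apply/arcP; left; exists e.
(* The edges are swapped according to their tails. [RF] and [RF'] turn this into a rule on heads, so
   that all edges into a vertex, and likewise all edges out of it, come from a single flow. *)
have indegA v : indeg A v = if R v then indeg F' v else indeg F v.
  rewrite /indeg; case: ifP => Rv; apply: eq_card => e; rewrite !inE;
    case: eqP => [ev|]; rewrite ?andbF ?andbT //; subst v.
    by case: ifP => // eK; apply/idP/idP => [/arcF/RF|/arcF'/RF']; rewrite eK Rv.
  by case: ifP => // eK; apply/idP/idP => [/arcF'/RF'|/arcF/RF]; rewrite eK Rv.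
have indegB v : indeg B v = if R v then indeg F v else indeg F' v.
  rewrite /indeg; case: ifP => Rv; apply: eq_card => e; rewrite !inE;
    case: eqP => [ev|]; rewrite ?andbF ?andbT //; subst v.
    by case: ifP => // eK; apply/idP/idP => [/arcF'/RF'|/arcF/RF]; rewrite eK Rv.
  by case: ifP => // eK; apply/idP/idP => [/arcF/RF|/arcF'/RF']; rewrite eK Rv.
have outdegA v : outdeg A v = if v \in K then outdeg F' v else outdeg F v.
  rewrite /outdeg; case: ifP => vK; apply: eq_card => e; rewrite !inE;
    by case: eqP => [->|]; rewrite ?andbF ?andbT // vK.
have outdegB v : outdeg B v = if v \in K then outdeg F v else outdeg F' v.
  rewrite /outdeg; case: ifP => vK; apply: eq_card => e; rewrite !inE;
    by case: eqP => [->|]; rewrite ?andbF ?andbT // vK.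
(* A vertex may be entered along one flow and left along the other only if [K] and [R] disagree
   there. Both flows then visit it, since an unvisited vertex carries a loop arc, on which [K] and
   [R] agree. Hence the balance survives the mixing. *)
have visitsF v : (v \in K) != R v -> visits F S v = 1.
  move=> KR; have [_] := fl v; have [v0'|] := posnP (visits F S v); last by lia.
  by move: KR; rewrite (RF _ _ (arc_loop v0')) eqxx.
have visitsF' v : (v \in K) != R v -> visits F' (s |: S) v = 1.
  move=> KR; have [_] := fl' v; have [v0'|] := posnP (visits F' (s |: S) v); last by lia.
  by move: KR; rewrite (RF' _ _ (arc_loop v0')) eqxx.
have mixed (a b : bool) x y x' y' : x = y /\ x <= 1 -> x' = y' /\ x' <= 1 ->
    (a != b -> x = 1) -> (a != b -> x' = 1) ->
    (if b then x else x') = (if a then y else y') /\ (if b then x else x') <= 1.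
  move=> [<- x1] [<- x1'].
  by case: a b => -[] //= => /(_ isT) xE /(_ isT) xE'; rewrite ?xE ?xE'.
exists t, A, B; split.
- by rewrite inE tT' KT.
- move=> v; have -> : visits A (s |: S) v = if R v then visits F' (s |: S) v else visits F S v.
    rewrite /visits indegA in_setU1; case: ifP => // nR.
    by case: eqP => // vs; rewrite vs Rs in nR.
  rewrite outdegA.
  have -> : (v \in t |: T) = if v \in K then v \in T' else v \in T.
    rewrite in_setU1; case: ifP => [vK|]; last by case: eqP => // ->; rewrite tK.
    by rewrite KT' // (negPf (KT _ vK)) orbF.
  by have := mixed _ _ _ _ _ _ (fl' v) (fl v) (visitsF' v) (visitsF v); case: (v \in K).
- move=> v; have -> : visits B S v = if R v then visits F S v else visits F' (s |: S) v.
    rewrite /visits indegB in_setU1; case: ifP => // nR.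
    by case: eqP => // vs; rewrite vs Rs in nR.
  rewrite outdegB.
  have -> : (v \in T' :\ t) = if v \in K then v \in T else v \in T'.
    rewrite in_setD1; case: ifP => [vK|]; last by case: eqP => // ->; rewrite tK.
    by rewrite KT' // (negPf (KT _ vK)) andNb.
  by have := mixed _ _ _ _ _ _ (fl v) (fl' v) (visitsF v) (visitsF' v); case: (v \in K).
- by move=> e; rewrite !inE; case: ifP => _ //; rewrite addnC.
Qed.

End Flow.

(** * Flows and routes *)

Section FlowRoutes.
Variables (n : nat) (N : network n).
Implicit Types (F : {set edge N}) (S T : {set vertex N}) (v : vertex N).

Definition ranked (rk : vertex N -> nat) := forall e, rk (tail e) < rk (head e).

Lemma indegD1 F e v : e \in F -> indeg F v = (head e == v) + indeg (F :\ e) v.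
Proof.
move=> eF; rewrite /indeg (cardsD1 e) inE eF /=; congr (_ + _).
by apply: eq_card => f; rewrite !inE andbA.
Qed.

Lemma outdegD1 F e v : e \in F -> outdeg F v = (tail e == v) + outdeg (F :\ e) v.
Proof.
move=> eF; rewrite /outdeg (cardsD1 e) inE eF /=; congr (_ + _).
by apply: eq_card => f; rewrite !inE andbA.
Qed.

Lemma indeg0 v : indeg set0 v = 0.
Proof. by apply: eq_card0 => e; rewrite !inE. Qed.

Lemma outdeg0 v : outdeg set0 v = 0.
Proof. by apply: eq_card0 => e; rewrite !inE. Qed.

Lemma enumD1 (X : finType) (A : {set X}) x :
  x \in A -> perm_eq (enum A) (x :: enum (A :\ x)).
Proof.
move=> xA; apply: uniq_perm; rewrite /= ?enum_uniq ?mem_enum ?setD11 // => y.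
by rewrite mem_enum in_cons mem_enum in_setD1; case: eqP => [->|].
Qed.

Lemma enumU1 (X : finType) (A : {set X}) x :
  x \notin A -> perm_eq (enum (x |: A)) (x :: enum A).
Proof.
move=> xA; apply: uniq_perm; rewrite /= ?enum_uniq ?mem_enum ?xA // => y.
by rewrite mem_enum in_cons mem_enum in_setU1.
Qed.

Lemma perm_flatten_map (X Y : eqType) (f : X -> seq Y) s t :
  perm_eq s t -> perm_eq (flatten (map f s)) (flatten (map f t)).
Proof. by move=> st; apply: perm_flatten; apply: perm_map. Qed.

(** Induction on the number of edges. Nothing in [F] enters the tail of an edge whose tail has least
    rank, so this tail is a source; the edge is removed and the source moved to its head. The clause
    on [visits] keeps the removed vertex off all the routes of the smaller flow. *)
Lemma flow_routes rk F S T : ranked rk -> flow F S T ->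
  exists r : vertex N -> seq (edge N),
  [/\ {in S, forall s, walk s (r s)},
      {in S, forall s x, x \in route_vertices (s, r s) -> visits F S x = 1},
      {in S &, forall s s', s != s' -> vertex_disjoint (s, r s) (s', r s')},
      [set route_end (s, r s) | s in S] = T &
      perm_eq (flatten [seq r s | s <- enum S]) (enum F)].
Proof.
move=> rkP; move cardF: #|F| => m; elim: m => [|m IH] in F S T cardF *.
  move/eqP: cardF; rewrite cards_eq0 => /eqP -> fl.
  have vE v : (v \in S) = (v \in T).
    by have [] := fl v; rewrite /visits indeg0 outdeg0 !add0n; case: (v \in S); case: (v \in T).
  exists (fun=> [::]); split=> //.
  - by move=> s sS x; rewrite mem_seq1 => /eqP->; rewrite /visits indeg0 sS.
  - by move=> s s' _ _ ss'; rewrite /vertex_disjoint disjoint_has /= orbF mem_seq1.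
  - by apply/setP => x; rewrite -vE imset_id.
  - by rewrite enum_set0; elim: (enum S).
move=> fl; have /card_gt0P[e0 e0F] : 0 < #|F| by rewrite cardF.
have [e eF emin] := arg_minnP (fun e => rk (tail e)) e0F; have {}eF : e \in F := eF.
set u := tail e in emin; pose v := head e.
have uv : u != v by apply/eqP => uv; have := rkP e; rewrite -/u uv ltnn.
have outu : outdeg F u > 0 by apply/outdeg_gt0; exists e.
have inv : indeg F v > 0 by apply/indeg_gt0; exists e.
have inu : indeg F u = 0.
  apply/eqP; rewrite -leqn0 leqNgt; apply/negP => /indeg_gt0[f fF fu].
  by have := rkP f; rewrite fu; have := emin f fF; lia.
have uS : u \in S.
  have [] := fl u; rewrite /visits inu; case: (u \in S) => //; lia.
have vS : v \notin S.
  by apply/negP => vS; have [_] := fl v; rewrite /visits vS; lia.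
pose S' := v |: S :\ u.
have visits' x : visits (F :\ e) S' x = if x == u then 0 else visits F S x.
  have := indegD1 x eF; rewrite /visits in_setU1 in_setD1 [x == v]eq_sym -/v.
  case: (x =P u) => [->|_] /=; first by rewrite [v == u]eq_sym (negPf uv) inu; lia.
  case: (v =P x) => [<-|_] /=; first by rewrite (negPf vS); lia.
  lia.
have fl' : flow (F :\ e) S' T.
  move=> x; rewrite visits'; have := outdegD1 x eF; rewrite -/u [u == x]eq_sym.
  have [] := fl x; case: eqP => [->|_] /=; last by lia.
  by rewrite /visits inu uS; case: (u \in T); lia.
have [|r' [r'w r'v r'd r'e r'F]] := IH _ S' T _ fl'.
  by move: cardF; rewrite (cardsD1 e) eF; lia.
pose r x := if x == u then e :: r' v else r' x.
have S'v : v \in S' by rewrite setU11.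
have S'P x : x \in S -> x != u -> x \in S' by move=> xS xu; rewrite in_setU1 in_setD1 xu xS orbT.
have notu s : s \in S' -> u \notin route_vertices (s, r' s).
  by move=> sS'; apply/negP => /(r'v _ sS'); rewrite visits' eqxx.
have vd s : s \in S -> s != u -> v != s.
  by move=> sS _; apply/eqP => vs; rewrite vs sS in vS.
have disj s : s \in S -> s != u ->
    [disjoint u :: route_vertices (v, r' v) & route_vertices (s, r' s)].
  move=> sS su; rewrite disjoint_cons (notu s (S'P s sS su)).
  exact: r'd S'v (S'P s sS su) (vd s sS su).
exists r; split.
- move=> s sS; rewrite /r; case: eqP => [->|/eqP su] /=; first by rewrite eqxx r'w.
  exact: r'w (S'P s sS su).
- move=> s sS x; rewrite /r; case: eqP => [->|/eqP su].
    rewrite /route_vertices /= in_cons => /orP[/eqP->|xv].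
      by rewrite /visits inu uS.
    have := r'v v S'v x xv; rewrite visits'; by case: eqP.
  by move=> /(r'v s (S'P s sS su)); rewrite visits'; case: eqP.
- move=> s s' sS s'S; rewrite /vertex_disjoint /r.
  case: (s =P u) => [->|/eqP su]; case: (s' =P u) => [->|/eqP s'u] ss'.
  + by rewrite eqxx in ss'.
  + exact: disj.
  + by rewrite disjoint_sym; apply: disj.
  + exact: r'd (S'P s sS su) (S'P s' s'S s'u) ss'.
- rewrite -r'e; apply/setP => x; apply/imsetP/imsetP => -[s sS ->].
    rewrite /r; case: eqP => [->|/eqP su]; first by exists v.
    by exists s; rewrite ?S'P.
  move: sS; rewrite in_setU1 in_setD1 => /orP[/eqP->|/andP[su sS]].
    by exists u; rewrite // /r eqxx.
  by exists s; rewrite // /r (negPf su).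
- apply: (perm_trans (perm_flatten_map _ (enumD1 uS))).
  rewrite perm_sym; apply: (perm_trans (enumD1 eF)); rewrite perm_sym.
  rewrite /= {1}/r eqxx /= perm_cons.
  move: r'F; apply: perm_trans; rewrite perm_sym.
  have vSu : v \notin S :\ u by rewrite in_setD1 (negPf vS) andbF.
  apply: (perm_trans (perm_flatten_map _ (enumU1 vSu))) => /=.
  rewrite perm_cat2l; apply/permP => a; congr (count a (flatten _)).
  by apply/eq_in_map => s; rewrite mem_enum in_setD1 => /andP[su _]; rewrite /r (negPf su).
Qed.

Lemma walk_rank rk v es x : ranked rk -> walk v es ->
  x \in route_vertices (v, es) -> rk v <= rk x.
Proof.
move=> rkP; elim: es v => [|e es IH] v /=; first by rewrite mem_seq1 => _ /eqP->.
move=> /andP[/eqP ev ws]; rewrite /route_vertices /= in_cons => /orP[/eqP-> //|xs].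
by have := IH _ ws xs; have := rkP e; rewrite ev; lia.
Qed.

Lemma flow_disjoint_union F F' S S' T T' : flow F S T -> flow F' S' T' ->
    (forall x, visits F S x = 0 \/ visits F' S' x = 0) ->
  [/\ flow (F :|: F') (S :|: S') (T :|: T'),
      perm_eq (enum (F :|: F')) (enum F ++ enum F') &
      forall x, visits (F :|: F') (S :|: S') x = visits F S x + visits F' S' x].
Proof.
move=> fl fl' disj.
have dF e : e \in F -> e \notin F'.
  move=> eF; apply/negP => eF'; have := arc_visits_head fl eF.
  by have := arc_visits_head fl' eF'; have [->|->] := disj (head e).
have indegU x : indeg (F :|: F') x = indeg F x + indeg F' x.
  rewrite !indegE -big_split /=; apply: eq_bigr => e _; rewrite inE.
  by have := dF e; case: (e \in F) => //= /(_ isT) /negPf ->.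
have outdegU x : outdeg (F :|: F') x = outdeg F x + outdeg F' x.
  rewrite !outdegE -big_split /=; apply: eq_bigr => e _; rewrite inE.
  by have := dF e; case: (e \in F) => //= /(_ isT) /negPf ->.
have visitsU x : visits (F :|: F') (S :|: S') x = visits F S x + visits F' S' x.
  rewrite /visits indegU in_setU; have := disj x; rewrite /visits.
  by case: (x \in S); case: (x \in S'); lia.
split=> //.
  move=> x; rewrite visitsU outdegU in_setU.
  have [a b] := fl x; have [a' b'] := fl' x; have := disj x; move: a b a' b'.
  by case: (x \in T); case: (x \in T') => /=; lia.
apply: uniq_perm; rewrite ?enum_uniq // ?cat_uniq ?enum_uniq /= ?andbT.
  by apply/hasPn => e; rewrite !mem_enum => eF'; apply/negP => /dF; rewrite eF'.
by move=> e; rewrite mem_cat !mem_enum in_setU.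
Qed.

(** Ranks increase along a walk, so it never returns to a vertex and its edges are pairwise
    distinct. *)
Lemma walk_flow rk v es : ranked rk -> walk v es ->
  exists F, [/\ flow F [set v] [set route_end (v, es)], perm_eq (enum F) es &
    forall x, visits F [set v] x = (x \in route_vertices (v, es))].
Proof.
move=> rkP; elim: es v => [|e es IH] v /=.
  exists set0; split=> [x||x].
  - by rewrite /visits indeg0 outdeg0 !in_set1; case: eqP.
  - by rewrite enum_set0.
  - by rewrite /visits indeg0 in_set1 mem_seq1.
move=> /andP[/eqP ev ws]; have [F [fl FE vis]] := IH _ ws.
have vn : v \notin route_vertices (head e, es).
  apply/negP => /(walk_rank rkP ws); have := rkP e; rewrite ev; lia.
have v0 : visits F [set head e] v = 0 by rewrite vis (negPf vn).
have eF : e \notin F.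
  by apply/negP => /(arc_visits_tail fl); rewrite ev v0.
have inU x : indeg (e |: F) x = (head e == x) + indeg F x.
  rewrite (indegD1 x (setU11 _ _)); congr (_ + indeg _ _).
  by apply/setP => f; rewrite in_setD1 in_setU1; case: eqP => [->|]; rewrite ?(negPf eF).
have outU x : outdeg (e |: F) x = (tail e == x) + outdeg F x.
  rewrite (outdegD1 x (setU11 _ _)); congr (_ + outdeg _ _).
  by apply/setP => f; rewrite in_setD1 in_setU1; case: eqP => [->|]; rewrite ?(negPf eF).
have visU x : visits (e |: F) [set v] x = (x == v) + visits F [set head e] x.
  by rewrite /visits inU !in_set1 [head e == x]eq_sym; lia.
exists (e |: F); split.
- move=> x; rewrite visU outU ev [v == x]eq_sym; have [] := fl x.
  rewrite /route_end /=; case: eqP => [->|_]; last by lia.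
  by rewrite v0; lia.
- by apply: (perm_trans (enumU1 eF)); rewrite perm_cons.
- move=> x; rewrite visU vis /route_vertices /= [in RHS]in_cons.
  by case: eqP => [->|//]; rewrite (negPf vn).
Qed.

Lemma routes_flow rk (ps : seq (route N)) : ranked rk ->
    all (fun p => walk p.1 p.2) ps -> pairwise (@vertex_disjoint n N) ps ->
  exists F, [/\ flow F [set x in map fst ps] [set x in map (@route_end n N) ps],
    perm_eq (enum F) (flatten (map snd ps)) &
    forall x, visits F [set x in map fst ps] x = has (fun p => x \in route_vertices p) ps].
Proof.
move=> rkP; elim: ps => [_ _|[v es] ps IH] /=.
  exists set0; split=> [x||x]; rewrite ?enum_set0 // /visits ?indeg0 ?outdeg0 !inE //.
move=> /andP[ves /IH{IH}IH] /andP[vps /IH[F [fl FE vis]]].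
have [F' [fl' FE' vis']] := walk_flow rkP ves.
have disj x : visits F' [set v] x = 0 \/ visits F [set x in map fst ps] x = 0.
  rewrite vis' vis; case: (boolP (x \in _)) => xv; last by left.
  right; apply/eqP; rewrite eqb0; apply/hasPn => p pps; apply/negP => xp.
  by have /allP/(_ p pps)/disjointFr/(_ xv) := vps; rewrite xp.
have [flU FU visU] := flow_disjoint_union fl' fl disj.
have SU (x : vertex N) s : [set y in x :: s] = [set x] :|: [set y in s].
  by apply/setP => y; rewrite !inE.
exists (F' :|: F); rewrite !SU; split=> //.
  by apply: (perm_trans FU); apply: perm_cat.
by move=> x; rewrite visU vis' vis; have := disj x; rewrite vis' vis; case: (x \in _); case: (has _ _) => // -[].
Qed.

End FlowRoutes.

(** * Heights of routes in a planar network *)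

Section Heights.
Import Order.TTheory GRing.Theory Num.Theory numFieldNormedType.Exports.
Local Open Scope classical_set_scope.
Local Open Scope ring_scope.
Variables (R : realType) (n : nat) (N : planar_network R n).
Let emb := planar_embedding N.
Implicit Types (v : vertex N) (e : edge N) (es : seq (edge N)) (x : R).

Local Notation xp := (xpos emb).
Local Notation yp := (ypos emb).
Local Notation cv := (curve emb).

(** The route seen as the graph of a function of the abscissa. At a joint the edge that ends there
    is used; the next one has the same value. Only abscissas between the two ends of the route
    matter. *)
Fixpoint height v es x : R :=
  if es is e :: es' then if x <= xp (head e) then cv e x else height (head e) es' x
  else yp v.

Lemma xpos_walk v es u : walk v es -> u \in route_vertices (v, es) -> xp v <= xp u.
Proof.
elim: es v => [|e es IH] v /=; first by rewrite mem_seq1 => _ /eqP->.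
move=> /andP[/eqP <- w]; rewrite /route_vertices /= in_cons => /orP[/eqP->//|uw].
exact: le_trans (ltW (edge_rightward emb e)) (IH _ w uw).
Qed.

Lemma route_end_in v es : route_end (v, es) \in route_vertices (v, es).
Proof. exact: mem_last. Qed.

Lemma tail_in_route v es e : walk v es -> e \in es -> tail e \in route_vertices (v, es).
Proof.
elim: es v => [|f es IH] v //= /andP[/eqP <- w]; rewrite in_cons.
move=> /predU1P[->|/(IH _ w) h]; first exact: mem_head.
by rewrite /route_vertices in_cons; apply/orP; right.
Qed.

Lemma head_in_route v es e : e \in es -> head e \in route_vertices (v, es).
Proof. by move=> ees; rewrite /route_vertices in_cons map_f ?orbT. Qed.

Lemma height_vertex v es u : walk v es -> u \in route_vertices (v, es) ->
  height v es (xp u) = yp u.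
Proof.
elim: es v u => [|e es IH] v u /=; first by rewrite mem_seq1 => _ /eqP->.
move=> /andP[/eqP <- w]; rewrite /route_vertices /= in_cons => /orP[/eqP->|uw].
  by rewrite ltW ?edge_rightward // curve_tail.
have := xpos_walk w uw; rewrite le_eqVlt => /orP[/eqP xE|]; last first.
  by rewrite ltNge => /negPf ->; exact: IH w uw.
rewrite -xE lexx curve_head -(IH _ _ w (mem_head _ _)) xE; exact: IH w uw.
Qed.

Lemma height_edge v es e x : walk v es -> e \in es ->
  xp (tail e) <= x <= xp (head e) -> height v es x = cv e x.
Proof.
elim: es v => [|f es IH] v //= /andP[_ w].
rewrite in_cons => /predU1P[->|ees] /andP[x1 x2]; first by rewrite x2.
have := le_trans (xpos_walk w (tail_in_route w ees)) x1.
rewrite le_eqVlt => /orP[/eqP xE|]; last first.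
  by rewrite ltNge => /negPf ->; apply: IH w ees _; rewrite x1.
rewrite -xE lexx curve_head -(height_vertex w (mem_head _ _)) xE.
by apply: IH w ees _; rewrite x1.
Qed.

Lemma height_cases v es x : walk v es -> xp v <= x <= xp (route_end (v, es)) ->
  (exists2 u, u \in route_vertices (v, es) & xp u = x) \/
  (exists2 e, e \in es & xp (tail e) < x < xp (head e)).
Proof.
elim: es v => [|e es IH] v /=.
  by rewrite /route_end => _ /le_anti xE; left; exists v; rewrite ?mem_head.
move=> /andP[/eqP <- w] /andP[x1 x2].
have [x3|x3] := leP (xp (head e)) x.
  have [|[u uw ux]|[f fes fx]] := IH _ w; first by rewrite x3.
    by left; exists u; rewrite // /route_vertices in_cons uw orbT.
  by right; exists f; rewrite ?in_cons ?fes ?orbT.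
move: x1; rewrite le_eqVlt => /orP[/eqP xE|x1].
  by left; exists (tail e); rewrite ?mem_head.
by right; exists e; rewrite ?mem_head ?x1.
Qed.

Lemma height_continuous v es : walk v es ->
  {within `[xp v, xp (route_end (v, es))], continuous (height v es)}.
Proof.
elim: es v => [|e es IH] v /=.
  by move=> _; apply: continuous_subspaceT => x; exact: cvg_cst.
move=> /andP[/eqP <- w].
have le1 := ltW (edge_rightward emb e).
have le2 : xp (head e) <= xp (route_end (tail e, e :: es)).
  exact: xpos_walk w (route_end_in _ _).
have -> : [set` `[xp (tail e), xp (route_end (tail e, e :: es))]] =
    `[xp (tail e), xp (head e)] `|` `[xp (head e), xp (route_end (head e, es))].
  apply/seteqP; split => x /=; rewrite !in_itv /=.
    by move=> /andP[-> ->]; rewrite andbT; apply/orP; exact: le_total.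
  move=> [/andP[-> /= a]|/andP[a ->]]; first exact: le_trans a le2.
  by rewrite (le_trans le1 a).
apply: withinU_continuous; [exact: interval_closed|exact: interval_closed| |].
  apply: (@subspace_eq_continuous _ _ _ (cv e)); last exact: curve_continuous.
  by move=> x; rewrite in_setE /from_subspace /= in_itv /= => /andP[_ ->].
apply: (@subspace_eq_continuous _ _ _ (height (head e) es)); last exact: IH.
move=> x; rewrite in_setE /from_subspace /= in_itv /= => /andP[]; rewrite le_eqVlt => /orP[/eqP <- _|].
  by rewrite lexx (height_vertex w (mem_head _ _)) curve_head.
by rewrite ltNge => /negPf ->.
Qed.

Lemma height_eq_vertex v es u : walk v es -> xp v <= xp u <= xp (route_end (v, es)) ->
  height v es (xp u) = yp u -> u \in route_vertices (v, es).
Proof.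
move=> w /(height_cases w)[[u' u'w xE]|[e ees ex]] h.
  by rewrite (pos_inj (esym xE)) // -h -xE height_vertex.
case: (edge_avoids_vertices ex); rewrite -h; apply/esym/height_edge => //.
by case/andP: ex => /ltW -> /ltW ->.
Qed.

Lemma height_eq_edge v es e x : walk v es -> xp v <= x <= xp (route_end (v, es)) ->
  xp (tail e) < x < xp (head e) -> height v es x = cv e x -> e \in es.
Proof.
move=> w /(height_cases w)[[u uw <-]|[f fes fx]] ex h.
  by case: (edge_avoids_vertices ex); rewrite -h height_vertex.
have [<- //|/eqP ef] := eqVneq f e.
case: (edges_do_not_cross ef fx ex); rewrite -h; apply/esym/height_edge => //.
by case/andP: fx => /ltW -> /ltW ->.
Qed.

(** By the intermediate value theorem the route would meet the edge strictly between its ends, where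
    the embedding allows neither a vertex nor another edge. The points [x] and [x'] may be ends of
    the edge, so that sides at a vertex and at an interior point can be compared. *)
Lemma height_same_side v es e x x' : walk v es ->
    xp v <= xp (tail e) -> xp (head e) <= xp (route_end (v, es)) -> e \notin es ->
    xp (tail e) <= x <= xp (head e) -> xp (tail e) <= x' <= xp (head e) ->
  cv e x < height v es x -> height v es x' < cv e x' -> False.
Proof.
move=> w le1 le2 /negP ees x12 x'12 a b; apply: ees.
pose d := (height v es - cv e : R -> R).
have dc : {within `[xp (tail e), xp (head e)], continuous d}.
  apply: within_continuousB; last exact: curve_continuous.
  apply: continuous_subspaceW (height_continuous w) => z /=; rewrite !in_itv /=.
  by move=> /andP[z1 z2]; rewrite (le_trans le1) // (le_trans z2).
have dx : 0 < d x by rewrite /d fctE subr_gt0.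
have dx' : d x' < 0 by rewrite /d fctE subr_lt0.
pose p := Num.min x x'; pose q := Num.max x x'.
have pq : p <= q by rewrite /p /q ge_min !le_max lexx.
have sub : `[p, q] `<=` [set` `[xp (tail e), xp (head e)]].
  move=> z /=; rewrite !in_itv /= /p /q ge_min le_max.
  move: x12 x'12 => /andP[? ?] /andP[? ?] /andP[/orP[]? /orP[]?]; apply/andP; split; lra.
have [|c cpq dc0] := IVT (v := 0) pq (continuous_subspaceW sub dc).
  by rewrite ge_min le_max /p /q; case: (leP x x') => _; rewrite (ltW dx) (ltW dx') ?orbT.
have := sub c cpq; rewrite /= in_itv /= => /andP[c1 c2].
have hc : height v es c = cv e c by move/eqP: dc0; rewrite /d fctE subr_eq0 => /eqP.
have cx : c != x by apply/eqP => cx; rewrite -cx dc0 ltxx in dx.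
have cx' : c != x' by apply/eqP => cx'; rewrite -cx' dc0 ltxx in dx'.
move: cpq; rewrite in_itv /= => /andP[c3 c4].
apply: (@height_eq_edge v es e c w _ _ hc).
  by rewrite (le_trans le1 c1) (le_trans c2 le2).
move: cx cx' x12 x'12 c3 c4; rewrite /p /q ge_min le_max => /eqP cx /eqP cx' /andP[? ?] /andP[? ?].
move=> /orP[]? /orP[]?; apply/andP; rewrite !lt_neqAle; split; apply/andP; split; try lra;
  apply/eqP => ?; lra.
Qed.

End Heights.

(** * Envelopes of two flows in a planar network *)

Section Lattice.
Import Order.TTheory GRing.Theory Num.Theory.
Variables (R : realType) (n : nat) (N : planar_network R n).
Let emb := planar_embedding N.
Implicit Types (F : {set edge N}) (S T : {set vertex N}) (v s : vertex N)
  (e f : edge N) (es : seq (edge N)) (I J : {set 'I_n}).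

Local Notation xp := (xpos emb).
Local Notation yp := (ypos emb).
Local Notation cv := (curve emb).

Definition full s es :=
  [/\ walk s es, xp s = 0%R & xp (route_end (s, es)) = width emb].

Definition mid e : R := ((xp (tail e) + xp (head e)) / 2)%R.

(** The midpoint is only a sample point: the side is constant along an edge outside the route. On an
    edge of the route itself the strict inequality fails. *)
Definition over s es e := (cv e (mid e) < height s es (mid e))%R.

Lemma mid_in e : (xp (tail e) < mid e < xp (head e))%R.
Proof. by have := edge_rightward emb e; rewrite /mid => ?; apply/andP; split; lra. Qed.

Lemma xp_ge0 v : (0 <= xp v)%R.
Proof. by have /andP[] := xpos_strip emb v. Qed.

Lemma xp_le_width v : (xp v <= width emb)%R.
Proof. by have /andP[] := xpos_strip emb v. Qed.

(** Frees the side from the sample point: any point of the closed edge that is off the route will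
    do, in particular an end of the edge that the route misses. *)
Lemma over_at s es e x : full s es -> e \notin es ->
    (xp (tail e) <= x <= xp (head e))%R -> height s es x <> cv e x ->
  over s es e = (cv e x < height s es x)%R.
Proof.
move=> [w s0 sW] ees xe hx; have /andP[m1 m2] := mid_in e.
have le1 : (xp s <= xp (tail e))%R by rewrite s0 xp_ge0.
have le2 : (xp (head e) <= xp (route_end (s, es)))%R by rewrite sW xp_le_width.
have me : (xp (tail e) <= mid e <= xp (head e))%R by rewrite !ltW.
have hm : height s es (mid e) != cv e (mid e).
  apply: contra ees => /eqP; apply: height_eq_edge => //; last by rewrite m1.
  by rewrite (le_trans le1 (ltW m1)) (le_trans (ltW m2) le2).
have side := height_same_side w le1 le2 ees.
rewrite /over; apply/idP/idP => a; rewrite ltNge le_eqVlt; apply/negP => /predU1P[b|b].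
- by case: hx.
- exact: side me xe a b.
- by rewrite b eqxx in hm.
- exact: side xe me a b.
Qed.

Lemma over_mem s es e : walk s es -> e \in es -> over s es e = false.
Proof.
move=> w ees; rewrite /over (height_edge w ees) ?ltxx //.
by have /andP[/ltW -> /ltW ->] := mid_in e.
Qed.

Lemma over_vertex s es e v : full s es -> head e = v \/ tail e = v ->
    v \notin route_vertices (s, es) ->
  over s es e = (yp v < height s es (xp v))%R.
Proof.
move=> fp ev vp; have [w s0 sW] := fp; have tw := ltW (edge_rightward emb e).
have cve : cv e (xp v) = yp v by case: ev => <-; rewrite ?curve_head ?curve_tail.
rewrite (over_at (x := xp v)) // ?cve //.
- apply: contra vp => ees.
  by case: ev => <-; [exact: head_in_route | exact: tail_in_route].
- by case: ev => <-; rewrite lexx tw.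
- move=> h; case/negP: vp; apply: height_eq_vertex w _ h.
  by rewrite s0 sW xp_ge0 xp_le_width.
Qed.

(** Above [x] the two routes follow [e] and [f], which do not meet there; both sides of the equation
    say that [f] is the lower one. *)
Lemma over_swap s es s' es' e f x : full s es -> full s' es' ->
    e \in es -> f \in es' -> e \notin es' -> f \notin es ->
    (xp (tail e) < x < xp (head e))%R -> (xp (tail f) < x < xp (head f))%R ->
  over s es f = ~~ over s' es' e.
Proof.
move=> fp fp' ees fes' ees' fes xe xf.
have xe' : (xp (tail e) <= x <= xp (head e))%R by case/andP: xe => /ltW -> /ltW ->.
have xf' : (xp (tail f) <= x <= xp (head f))%R by case/andP: xf => /ltW -> /ltW ->.
have [w _ _] := fp; have [w' _ _] := fp'.
have hx : height s es x = cv e x by apply: height_edge.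
have hx' : height s' es' x = cv f x by apply: height_edge.
have ef : e <> f by move=> ef; rewrite ef fes' in ees'.
have ne := edges_do_not_cross ef xe xf.
rewrite (over_at fp fes xf') hx // (over_at fp' ees' xe') hx'; last exact/nesym.
by rewrite -leNgt le_eqVlt; case: eqP => // /esym.
Qed.

Section Jump.
(** Minimum and maximum are treated together through the laws they share: a common successor can be
    pulled out, and each argument contributes an increment of at most one. *)
Variable op : nat -> nat -> nat.
Hypothesis opS : forall a b, op a.+1 b.+1 = (op a b).+1.
Hypothesis op_incl : forall a b, op a b <= op a.+1 b <= (op a b).+1.
Hypothesis op_incr : forall a b, op a b <= op a b.+1 <= (op a b).+1.

Lemma op_inc a b (x y : bool) : op a b <= op (a + x) (b + y) <= (op a b).+1.
Proof.
by case: x y => -[]; rewrite ?addn0 ?addn1 ?opS ?op_incl ?op_incr ?leqnSn ?leqnn.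
Qed.

(** The set whose counting function, the number of elements above a label, is [op] of the two given
    ones. If both sets are listed in decreasing order, [minn] gives the termwise minima, cut at the
    shorter list, and [maxn] the termwise maxima, with the surplus of the longer list kept. *)
Definition jump (I I' : {set 'I_n}) := [set i : 'I_n |
  op #|[set j in I | (i < j)%N]| #|[set j in I' | (i < j)%N]| <
  op (#|[set j in I | (i < j)%N]| + (i \in I)) (#|[set j in I' | (i < j)%N]| + (i \in I'))].

Definition count_over S (r : vertex N -> seq (edge N)) e := #|[set s in S | over s (r s) e]|.

Definition count_above S (r : vertex N -> seq (edge N)) v :=
  #|[set s in S | (yp v < height s (r s) (xp v))%R]|.

(* [r] decomposes the flow [F] into routes that run from [S] to the right side
   of the strip. *)
Definition tracks F S r :=
  [/\ {in S, forall s, full s (r s)},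
      {in S, forall s x, x \in route_vertices (s, r s) -> visits F S x = 1},
      {in S &, forall s s', s != s' -> vertex_disjoint (s, r s) (s', r s')} &
      perm_eq (flatten [seq r s | s <- enum S]) (enum F)].

Lemma tracks_mem F S r e : tracks F S r ->
  reflect (exists2 s, s \in S & e \in r s) (e \in F).
Proof.
move=> [_ _ _ rF]; rewrite -(mem_enum F) -(perm_mem rF).
by apply: (iffP flatten_mapP) => -[s sS es]; exists s; rewrite ?mem_enum // -mem_enum.
Qed.

Lemma count_over0 F S r e v : tracks F S r -> head e = v \/ tail e = v ->
  visits F S v = 0 -> count_over S r e = count_above S r v.
Proof.
move=> [fp vis _ _] ev v0; apply: eq_card => s; rewrite !inE.
case: (boolP (s \in S)) => //= sS; rewrite (over_vertex (fp s sS) ev) //.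
by apply/negP => /(vis s sS); rewrite v0.
Qed.

(** A route that misses [v] lies on the same side of [v] and of every edge at [v]. As the routes are
    disjoint, only the one through [v] can change the count. *)
Lemma count_over1 F S r e v s : tracks F S r -> head e = v \/ tail e = v ->
    s \in S -> v \in route_vertices (s, r s) ->
  count_over S r e = count_above S r v + over s (r s) e.
Proof.
move=> [fp _ disj _] ev sS vs.
have other s' : s' \in S -> s' != s -> v \notin route_vertices (s', r s').
  by move=> s'S ss'; rewrite (disjointFl (disj _ _ s'S sS ss')).
rewrite /count_over (cardsD1 s) inE sS /= addnC; congr (_ + _).
apply: eq_card => s'; rewrite !inE.
have [->|ss'] /= := eqVneq s' s.
  by have [w _ _] := fp s sS; rewrite (height_vertex w vs) ltxx andbF.
by case: (boolP (s' \in S)) => //= s'S; rewrite (over_vertex (fp _ s'S) ev) ?other.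
Qed.

Section TwoFlows.
Variables (F F' : {set edge N}) (S S' T T' : {set vertex N}).
Variables (r r' : vertex N -> seq (edge N)).
Hypotheses (fl : flow F S T) (fl' : flow F' S' T').
Hypotheses (tr : tracks F S r) (tr' : tracks F' S' r').

Definition jump_flow := [set e |
  op (count_over S r e) (count_over S' r' e) <
  op (count_over S r e + (e \in F)) (count_over S' r' e + (e \in F'))].

Lemma jump_flowE e : (e \in jump_flow) + op (count_over S r e) (count_over S' r' e) =
  op (count_over S r e + (e \in F)) (count_over S' r' e + (e \in F')) :> nat.
Proof.
have /andP[] := op_inc (count_over S r e) (count_over S' r' e) (e \in F) (e \in F').
rewrite inE; lia.
Qed.

(** [g] is [head] or [tail], so that one computation gives in-degrees and out-degrees. The edges of
    the two flows on this side of [v] are crossed from top to bottom, and the increments of [op]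
    telescope to the increment across [v]. The second hypothesis lets two such edges be compared
    above a common abscissa. *)
Lemma jump_degree (g : edge N -> vertex N) v :
    (forall e, g e = v -> head e = v \/ tail e = v) ->
    (forall e f, g e = v -> g f = v -> exists x,
      (xp (tail e) < x < xp (head e))%R /\ (xp (tail f) < x < xp (head f))%R) ->
    #|[set e in F | g e == v]| = visits F S v ->
    #|[set e in F' | g e == v]| = visits F' S' v ->
  #|[set e in jump_flow | g e == v]| + op (count_above S r v) (count_above S' r' v) =
  op (count_above S r v + visits F S v) (count_above S' r' v + visits F' S' v).
Proof.
move=> gP gx dF dF'.
have [_ vF1] := fl v; have [_ vF'1] := fl' v.
set a := count_above S r v; set b := count_above S' r' v.
have uniq0 (A : {set edge N}) k : k <= 1 -> #|[set e in A | g e == v]| = k ->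
    k = 0 /\ (forall e, g e = v -> e \notin A) \/
    k = 1 /\ exists e, [/\ g e = v, e \in A & forall f, g f = v -> (f \in A) = (f == e)].
  case: k => [|[|//]] _ kE; [left|right]; split=> //.
    move=> e ge; apply/negP => eA; move/eqP: kE; rewrite cards_eq0 => /eqP/setP/(_ e).
    by rewrite !inE eA ge eqxx.
  move/eqP: kE => /cards1P[e /setP eE]; exists e.
  have eA f : g f = v -> (f \in A) = (f == e) by move=> gf; have := eE f; rewrite !inE gf eqxx andbT.
  have := eE e; rewrite !inE eqxx => /andP[eA' /eqP ge]; split=> //.
have jump0 e : e \notin F -> e \notin F' -> e \notin jump_flow.
  by move=> /negPf eF /negPf eF'; rewrite inE eF eF' !addn0 ltnn.
have card1 e : g e = v -> (forall f, g f = v -> f \in jump_flow -> f = e) ->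
    #|[set f in jump_flow | g f == v]| = (e \in jump_flow).
  move=> ge h; case: (boolP (e \in _)) => eJ.
    apply/eqP/cards1P; exists e; apply/setP => f; rewrite in_set1 in_set.
    by apply/andP/eqP => [[fJ /eqP gf]|->]; [exact: h | rewrite ge eqxx].
  apply: eq_card0 => f; rewrite in_set; apply/negP => /andP[fJ /eqP gf].
  by case/negP: eJ; rewrite -(h f gf fJ).
have [[v0 FN]|[v1 [e [ge eF eu]]]] := uniq0 F _ vF1 dF;
have [[v0' FN']|[v1' [f [gf fF' fu]]]] := uniq0 F' _ vF'1 dF'.
- rewrite v0 v0' !addn0; apply/eqP; rewrite -{2}[op a b]add0n eqn_add2r cards_eq0.
  apply/eqP/setP => e; rewrite in_set in_set0; apply/negP => /andP[eJ /eqP ge].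
  by have := jump0 e (FN e ge) (FN' e ge); rewrite eJ.
- rewrite (card1 f gf); last first.
    move=> e ge eJ; apply/eqP; apply: contraLR eJ => ef.
    by rewrite jump0 ?FN // fu.
  have [s sS fs] := tracks_mem _ tr' fF'.
  have vs : v \in route_vertices (s, r' s).
    have [/(_ s sS) [w _ _] _ _ _] := tr'.
    by case: (gP f gf) => <-; [exact: head_in_route | exact: tail_in_route].
  have := jump_flowE f; rewrite (count_over0 tr (gP f gf) v0).
  rewrite (count_over1 tr' (gP f gf) sS vs) over_mem // ?addn0; last by have [/(_ s sS)[]] := tr'.
  by rewrite fF' (negPf (FN f gf)) v0 v1'.
- rewrite (card1 e ge); last first.
    move=> f gf fJ; apply/eqP; apply: contraLR fJ => ef.
    by rewrite jump0 ?FN' // eu.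
  have [s sS es] := tracks_mem _ tr eF.
  have vs : v \in route_vertices (s, r s).
    have [/(_ s sS) [w _ _] _ _ _] := tr.
    by case: (gP e ge) => <-; [exact: head_in_route | exact: tail_in_route].
  have := jump_flowE e; rewrite (count_over0 tr' (gP e ge) v0').
  rewrite (count_over1 tr (gP e ge) sS vs) over_mem // ?addn0; last by have [/(_ s sS)[]] := tr.
  by rewrite eF (negPf (FN' e ge)) v1 v0'.
have [s sS es] := tracks_mem _ tr eF; have [s' s'S fs'] := tracks_mem _ tr' fF'.
have fp : full s (r s) by have [/(_ s sS)] := tr.
have fp' : full s' (r' s') by have [/(_ s' s'S)] := tr'.
have [w _ _] := fp; have [w' _ _] := fp'.
have vs : v \in route_vertices (s, r s).
  by case: (gP e ge) => <-; [exact: head_in_route | exact: tail_in_route].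
have vs' : v \in route_vertices (s', r' s').
  by case: (gP f gf) => <-; [exact: head_in_route | exact: tail_in_route].
rewrite v1 v1'.
have := jump_flowE e; have := jump_flowE f.
rewrite !(count_over1 tr (gP _ _) sS vs) // !(count_over1 tr' (gP _ _) s'S vs') //.
rewrite (over_mem w es) (over_mem w' fs') !addn0 -/a -/b eF fF' (eu f gf) (fu e ge) [f == e]eq_sym.
have [ef|ef] := eqVneq e f.
  rewrite -ef in fs' *; rewrite (over_mem w es) (over_mem w' fs') !addn0 => _ <-.
  rewrite (card1 e ge) // => f' gf' f'J; apply/eqP; apply: contraLR f'J => ef'.
  by rewrite jump0 ?eu ?fu // -ef.
have es' : e \notin r' s'.
  apply/negP => es'; have : e \in F' by apply/(tracks_mem _ tr'); exists s'.
  by rewrite fu // (negPf ef).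
have fs : f \notin r s.
  apply/negP => fs; have : f \in F by apply/(tracks_mem _ tr); exists s.
  by rewrite eu // eq_sym (negPf ef).
have [x [xe xf]] := gx e f ge gf.
rewrite (over_swap fp fp' es fs' es' fs xe xf).
have -> : #|[set h in jump_flow | g h == v]| = (e \in jump_flow) + (f \in jump_flow).
  rewrite (cardsD1 e) (cardsD1 f) !in_setD1 !in_set ge gf !eqxx /= !andbT.
  rewrite [f == e]eq_sym ef /= addnA.
  rewrite eq_card0 ?addn0 // => h; rewrite !inE; apply/negP => /and4P[hf he hJ /eqP gh].
  by have := jump0 h; rewrite eu // fu // he hf inE hJ => /(_ isT isT).
(* The counts at the lower edge already include the route through the upper one, so the value of
   [op] reached after the upper edge is the value before the lower edge. *)
case: (over s' _ _) => /=; rewrite ?addn0 ?addn1 => hf he.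
  by rewrite -he -hf addnA.
by rewrite -hf -he addnCA addnA.
Qed.

End TwoFlows.

Lemma source_in0 i F : indeg F (source N i) = 0.
Proof.
apply/eqP; rewrite -leqn0 leqNgt; apply/negP => /indeg_gt0[e _ he].
have := edge_rightward emb e; rewrite he.
have [_ ->] := xpos_eq0 emb (source N i); last by exists i.
by rewrite ltNge xp_ge0.
Qed.

Lemma sink_out0 i F : outdeg F (sink N i) = 0.
Proof.
apply/eqP; rewrite -leqn0 leqNgt; apply/negP => /outdeg_gt0[e _ he].
have := edge_rightward emb e; rewrite he.
have [_ ->] := xpos_eq_width emb (sink N i); last by exists i.
by rewrite ltNge xp_le_width.
Qed.

Lemma source_neq_sink i j : source N i != sink N j.
Proof.
apply/eqP => ij; have := width_gt0 emb.
have [_ <-] := xpos_eq_width emb (sink N j); last by exists j.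
have [_ ] := xpos_eq0 emb (source N i); rewrite ij => -> ; last by exists i.
by rewrite ltxx.
Qed.

Lemma mem_imset_source i I : (source N i \in [set source N j | j in I]) = (i \in I).
Proof. exact/mem_imset/source_inj. Qed.

Lemma mem_imset_sink i I : (sink N i \in [set sink N j | j in I]) = (i \in I).
Proof. exact/mem_imset/sink_inj. Qed.

(** Turns the order of the real abscissas into a rank with natural values. *)
Definition column_rank v := #|[set u | (xp u < xp v)%R]|.

Lemma column_ranked : ranked column_rank.
Proof.
move=> e; apply: proper_card; apply/properP; split.
  by apply/fintype.subsetP => u; rewrite !inE => /lt_trans; apply; exact: edge_rightward.
by exists (tail e); rewrite !inE ?ltxx // edge_rightward.
Qed.

Section SourceSink.
Variables (F : {set edge N}) (I J : {set 'I_n}).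
Let S := [set source N i | i in I].
Let T := [set sink N j | j in J].
Hypothesis fl : flow F S T.

Lemma flow_tracks : exists r, tracks F S r /\ [set route_end (s, r s) | s in S] = T.
Proof.
have [r [rw rv rd rT rF]] := flow_routes column_ranked fl.
exists r; split=> //; split=> // s sS; split; first exact: rw.
  by have /imsetP[i _ ->] := sS; apply/xpos_eq0; exists i.
have : route_end (s, r s) \in T by rewrite -rT imset_f.
by move=> /imsetP[j _ ->]; apply/xpos_eq_width; exists j.
Qed.

Lemma ypos_source_lt i j : (yp (source N i) < yp (source N j))%R = (i < j).
Proof.
case: (ltngtP i j) => ij; first by rewrite ypos_source.
  by apply/negbTE; rewrite -leNgt ltW // ypos_source.
by rewrite (val_inj ij) ltxx.
Qed.

Lemma ypos_sink_lt i j : (yp (sink N i) < yp (sink N j))%R = (i < j).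
Proof.
case: (ltngtP i j) => ij; first by rewrite ypos_sink.
  by apply/negbTE; rewrite -leNgt ltW // ypos_sink.
by rewrite (val_inj ij) ltxx.
Qed.

Lemma count_above_source r i : tracks F S r ->
  count_above S r (source N i) = #|[set j in I | (i < j)%N]|.
Proof.
move=> [fp _ _ _]; rewrite -(card_imset _ (@source_inj n N)); apply: eq_card => s.
rewrite in_set; apply/andP/imsetP => [[sS]|[j jI ->]].
  have [w s0 _] := fp s sS.
  have -> : xp (source N i) = xp s by rewrite s0; apply/xpos_eq0; exists i.
  rewrite (height_vertex w (mem_head _ _)).
  have /imsetP[j jI ->] := sS; rewrite ypos_source_lt => ij.
  by exists j; rewrite // inE jI.
move: jI; rewrite inE => /andP[jI ij]; have jS := imset_f (source N) jI; split=> //.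
have [w s0 _] := fp _ jS.
have -> : xp (source N i) = xp (source N j) by rewrite s0; apply/xpos_eq0; exists i.
by rewrite (height_vertex w (mem_head _ _)) ypos_source_lt.
Qed.

Lemma count_above_sink r i : tracks F S r -> [set route_end (s, r s) | s in S] = T ->
  count_above S r (sink N i) = #|[set j in J | (i < j)%N]|.
Proof.
move=> [fp _ disj _] rT.
have end_height s : s \in S -> height s (r s) (xp (sink N i)) = yp (route_end (s, r s)).
  move=> sS; have [w _ sW] := fp s sS.
  have -> : xp (sink N i) = xp (route_end (s, r s)).
    by rewrite sW; apply/xpos_eq_width; exists i.
  exact: height_vertex w (route_end_in _ _).
have end_inj : {in [set s in S | (yp (sink N i) < height s (r s) (xp (sink N i)))%R] &,
    injective (fun s => route_end (s, r s))}.
  move=> s s'; rewrite !in_set => /andP[sS _] /andP[s'S _] ss'; apply/eqP/negPn/negP => neq.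
  have := disjointFr (disj _ _ sS s'S neq) (route_end_in _ _).
  by rewrite ss' route_end_in.
rewrite /count_above -(card_in_imset end_inj) -(card_imset _ (@sink_inj n N)).
apply: eq_card => t; apply/imsetP/imsetP => [[s]|[j]].
  rewrite in_set => /andP[sS]; rewrite end_height // => lt ->.
  have : route_end (s, r s) \in T by rewrite -rT imset_f.
  move=> /imsetP[j jJ jE]; exists j => //.
  by rewrite inE jJ -ypos_sink_lt -jE.
rewrite in_set => /andP[jJ ij] ->; have := imset_f (sink N) jJ; rewrite -/T -rT.
move=> /imsetP[s sS sE]; exists s => //; rewrite in_set sS end_height //.
by rewrite -sE ypos_sink_lt.
Qed.

End SourceSink.

(** Both the number of paths arriving at [v] and the number leaving it equal the increment of [op]
    from the paths above [v] to those at or above [v]; hence they agree, and they are at most one.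
    On the sides of the strip, where edges are missing, the same increment taken on labels is the
    membership in [jump]. *)
Lemma flow_jump F F' I I' J J' (S := fun A : {set 'I_n} => [set source N i | i in A])
    (T := fun A : {set 'I_n} => [set sink N i | i in A]) r r' :
    flow F (S I) (T J) -> flow F' (S I') (T J') ->
    tracks F (S I) r -> [set route_end (s, r s) | s in S I] = T J ->
    tracks F' (S I') r' -> [set route_end (s, r' s) | s in S I'] = T J' ->
  flow (jump_flow F F' (S I) (S I') r r') (S (jump I I')) (T (jump J J')).
Proof.
move=> fl fl' tr rT tr' rT' v; set G := jump_flow _ _ _ _ _ _.
have in_deg : (forall i, v <> source N i) ->
    indeg G v + op (count_above (S I) r v) (count_above (S I') r' v) =
    op (count_above (S I) r v + visits F (S I) v) (count_above (S I') r' v + visits F' (S I') v).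
  move=> vs.
  have nS A : (v \in S A) = false by apply/imsetP => -[i _ /vs].
  apply: (jump_degree fl fl' tr tr'); rewrite /visits ?nS ?addn0 //; first by left.
  move=> e f ev fv; have /andP[e1 e2] := mid_in e; have /andP[f1 f2] := mid_in f.
  (* Edges with a common head overlap just to its left, so the larger of their midpoints lies over
     both. For a common tail the smaller one does. *)
  exists (Num.max (mid e) (mid f)); rewrite !lt_max !gt_max e1 e2 f1 f2 ?orbT /=.
  by move: e2 f2; rewrite ev fv => -> ->.
have out_deg : (forall i, v <> sink N i) ->
    outdeg G v + op (count_above (S I) r v) (count_above (S I') r' v) =
    op (count_above (S I) r v + visits F (S I) v) (count_above (S I') r' v + visits F' (S I') v).
  move=> vs.
  have nT A : (v \in T A) = false by apply/imsetP => -[i _ /vs].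
  apply: (jump_degree fl fl' tr tr').
  - by right.
  - move=> e f ev fv; have /andP[e1 e2] := mid_in e; have /andP[f1 f2] := mid_in f.
    exists (Num.min (mid e) (mid f)); rewrite !gt_min !lt_min e1 e2 f1 f2 ?orbT /= ?andbT.
    by move: e1 f1; rewrite ev fv => -> ->.
  - by have [-> _] := fl v; rewrite nT addn0.
  - by have [-> _] := fl' v; rewrite nT addn0.
have jump1 : op (count_above (S I) r v + visits F (S I) v)
    (count_above (S I') r' v + visits F' (S I') v) <=
    (op (count_above (S I) r v) (count_above (S I') r' v)).+1.
  have [_ v1] := fl v; have [_ v1'] := fl' v.
  have := op_inc (count_above (S I) r v) (count_above (S I') r' v)
    (0 < visits F (S I) v) (0 < visits F' (S I') v).
  by case: (visits F _ v) v1 => [|[]] // _; case: (visits F' _ v) v1' => [|[]] // _ /andP[].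
have visE : visits G (S (jump I I')) v + op (count_above (S I) r v) (count_above (S I') r' v) =
    op (count_above (S I) r v + visits F (S I) v) (count_above (S I') r' v + visits F' (S I') v).
  have [[i vi]|/forallNP vs] := pselect (exists i, v = source N i); last first.
    have nS A : (v \in S A) = false by apply/imsetP => -[i _ /vs].
    by rewrite {1}/visits nS addn0 in_deg.
  rewrite /visits vi !source_in0 !mem_imset_source !add0n.
  rewrite (count_above_source _ tr) (count_above_source _ tr') inE.
  have /andP[] := op_inc #|[set j in I | (i < j)%N]| #|[set j in I' | (i < j)%N]| (i \in I) (i \in I').
  by case: leqP => //; lia.
have outE : outdeg G v + (v \in T (jump J J')) + op (count_above (S I) r v) (count_above (S I') r' v) =
    op (count_above (S I) r v + visits F (S I) v) (count_above (S I') r' v + visits F' (S I') v).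
  have [[i vi]|/forallNP vs] := pselect (exists i, v = sink N i); last first.
    have nT A : (v \in T A) = false by apply/imsetP => -[i _ /vs].
    by rewrite nT addn0 out_deg.
  have [-> _] := fl v; have [-> _] := fl' v.
  rewrite vi !sink_out0 !mem_imset_sink !add0n.
  rewrite (count_above_sink _ tr rT) (count_above_sink _ tr' rT') inE.
  have /andP[] := op_inc #|[set j in J | (i < j)%N]| #|[set j in J' | (i < j)%N]| (i \in J) (i \in J').
  by case: leqP => //; lia.
by split; lia.
Qed.

End Jump.
End Lattice.

(** Multiplicities are preserved because a minimum and a maximum add up to the sum of the arguments;
    this is applied to the counts strictly over an edge and to the counts that include the edge. *)
Lemma flow_lattice (R : realType) n (N : planar_network R n) (F F' : {set edge N})
    (I I' J J' : {set 'I_n}) (S := fun A : {set 'I_n} => [set source N i | i in A])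
    (T := fun A : {set 'I_n} => [set sink N i | i in A]) :
    flow F (S I) (T J) -> flow F' (S I') (T J') ->
  exists A B, [/\ flow A (S (jump minn I I')) (T (jump minn J J')),
    flow B (S (jump maxn I I')) (T (jump maxn J J')) &
    forall e, (e \in A) + (e \in B) = (e \in F) + (e \in F')].
Proof.
move=> fl fl'; have [r [tr rT]] := flow_tracks fl; have [r' [tr' rT']] := flow_tracks fl'.
exists (jump_flow minn F F' (S I) (S I') r r'), (jump_flow maxn F F' (S I) (S I') r r').
split.
- by apply: flow_jump tr rT tr' rT' => // [a b|a b|a b]; lia.
- by apply: flow_jump tr rT tr' rT' => // [a b|a b|a b]; lia.
move=> e; have := @jump_flowE _ _ N minn _ _ _ F F' (S I) (S I') r r' e.
have := @jump_flowE _ _ N maxn _ _ _ F F' (S I) (S I') r r' e.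
have := addn_min_max (count_over (S I) r e) (count_over (S I') r' e).
have := addn_min_max (count_over (S I) r e + (e \in F)) (count_over (S I') r' e + (e \in F')).
move=> h1 h2 h3 h4.
have {}h3 := h3 ltac:(lia) ltac:(lia) ltac:(lia); have {}h4 := h4 ltac:(lia) ltac:(lia) ltac:(lia).
lia.
Qed.

(** * Envelopes of sets of labels *)

Section IndexSets.
Variable n : nat.
Implicit Types (I : {set 'I_n}) (i j : 'I_n).

Definition below a : {set 'I_n} := [set i : 'I_n | (i < a)%N].
Definition top a : {set 'I_n} := [set i : 'I_n | (n - a <= i)%N].

Lemma count_ord (P : pred nat) : #|[set i : 'I_n | P i]| = \sum_(0 <= k < n) P k.
Proof.
rewrite big_mkord -sum1_card (eq_bigl (fun i : 'I_n => P i)) ?big_mkcond /=.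
  by apply: eq_bigr => i _; case: (P i).
by move=> i; rewrite inE.
Qed.

Lemma sum_lt a m : \sum_(0 <= k < m) ((k < a)%N : nat) = minn a m.
Proof. by elim: m => [|m IH]; [rewrite big_geq //; lia | rewrite big_nat_recr //= IH; lia]. Qed.

Lemma count_below a i : a <= n -> #|[set j in below a | (i < j)%N]| = a - i.+1.
Proof.
move=> an.
have -> : #|[set j in below a | (i < j)%N]| = #|[set j : 'I_n | ((j < a) && (i < j))%N]|.
  by apply: eq_card => j; rewrite !inE.
rewrite (count_ord (fun k => (k < a) && (i < k))%N).
suff h m : \sum_(0 <= k < m) (((k < a) && (i < k))%N : nat) = minn a m - i.+1.
  by rewrite h; lia.
by elim: m => [|m IH]; [rewrite big_geq //; lia | rewrite big_nat_recr //= IH; lia].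
Qed.

Lemma count_top a i : a <= n -> #|[set j in top a | (i < j)%N]| = minn a (n - i.+1).
Proof.
move=> an.
have -> : #|[set j in top a | (i < j)%N]| = #|[set j : 'I_n | ((n - a <= j) && (i < j))%N]|.
  by apply: eq_card => j; rewrite !inE.
rewrite (count_ord (fun k => (n - a <= k) && (i < k))%N).
suff h m : \sum_(0 <= k < m) (((n - a <= k) && (i < k))%N : nat) = m - maxn (n - a) i.+1.
  by rewrite h; lia.
by elim: m => [|m IH]; [rewrite big_geq //; lia | rewrite big_nat_recr //= IH; lia].
Qed.

Lemma card_below a : a <= n -> #|below a| = a.
Proof. by move=> an; rewrite (count_ord (fun k => k < a)%N) sum_lt; lia. Qed.

Lemma count_le I i : #|[set j in I | (i < j)%N]| + (i \in I) <= #|I|.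
Proof.
rewrite [#|I|](cardsD1 i) addnC leq_add2l; apply/subset_leq_card/fintype.subsetP => j.
by rewrite !inE => /andP[-> ij]; rewrite andbT; apply/eqP => ji; rewrite ji ltnn in ij.
Qed.

Lemma notin_disjoint_below a I i : [disjoint below a & I] -> (i < a)%N -> i \notin I.
Proof. by move=> aI ia; apply/negP => /(disjointFl aI); rewrite inE ia. Qed.

Lemma count_disjoint a I i : [disjoint below a & I] -> (i <= a)%N ->
  #|[set j in I | (i < j)%N]| + (i \in I) = #|I|.
Proof.
move=> aI ia; rewrite [#|I|](cardsD1 i) addnC; congr (_ + _).
apply: eq_card => j; rewrite !inE andbC; case: (boolP (j \in I)) => /=; last by rewrite !andbF.
move=> jI; rewrite !andbT; have : (a <= j)%N.
  by rewrite leqNgt; apply/negP => /(notin_disjoint_below aI); rewrite jI.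
by rewrite -val_eqE /=; lia.
Qed.

Lemma count_belowU a I i : a <= n -> [disjoint below a & I] ->
  #|[set j in below a :|: I | (i < j)%N]| = a - i.+1 + #|[set j in I | (i < j)%N]|.
Proof.
move=> an aI; rewrite -(count_below i an) -cardsUI [X in _ = _ + X]eq_card0 ?addn0.
  by apply: eq_card => j; rewrite !inE andb_orl.
move=> j; rewrite !inE; apply/negP => /andP[/andP[ja _] /andP[jI _]].
by have := disjointFl aI jI; rewrite inE ja.
Qed.

(** Separates the bottom block, which contributes a truncated difference to each count, from the
    other labels; what remains is arithmetic. *)
Lemma jump_belowU op a a' I I' i : a <= n -> a' <= n ->
    [disjoint below a & I] -> [disjoint below a' & I'] ->
  i \in jump op (below a :|: I) (below a' :|: I') =
  (op (a - i.+1 + #|[set j in I | (i < j)%N]|) (a' - i.+1 + #|[set j in I' | (i < j)%N]|) <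
   op (a - i + (#|[set j in I | (i < j)%N]| + (i \in I)))
      (a' - i + (#|[set j in I' | (i < j)%N]| + (i \in I')))).
Proof.
move=> an a'n aI aI'; rewrite inE !count_belowU //.
have mem b (K : {set 'I_n}) : [disjoint below b & K] ->
    b - i.+1 + #|[set j in K | (i < j)%N]| + (i \in below b :|: K) =
    b - i + (#|[set j in K | (i < j)%N]| + (i \in K)).
  move=> bK; rewrite in_setU [i \in below b]inE; case: (ltnP i b) => ib /=; last first.
    by rewrite addnA; congr (_ + _ + _); clear -ib; lia.
  rewrite (negPf (notin_disjoint_below bK ib)) addn0 addnAC; congr (_ + _).
  by clear -ib; lia.
by rewrite !mem.
Qed.

Section SplitCount.
Variables (a : nat) (I I' : {set 'I_n}).
Hypotheses (an : a < n) (aI : [disjoint below a & I]) (aI' : [disjoint below a.+1 & I']).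

Let bounds i :
  [/\ #|[set j in I | (i < j)%N]| + (i \in I) <= #|I|,
      #|[set j in I' | (i < j)%N]| + (i \in I') <= #|I'|,
      (i <= a)%N -> #|[set j in I | (i < j)%N]| + (i \in I) = #|I|,
      (i <= a.+1)%N -> #|[set j in I' | (i < j)%N]| + (i \in I') = #|I'| &
      ((i < a)%N -> (i \in I) = false) /\ ((i <= a)%N -> (i \in I') = false)].
Proof.
split; [exact: count_le | exact: count_le | exact: count_disjoint | exact: count_disjoint |].
by split=> ?; apply/negbTE; [apply: notin_disjoint_below aI _ | apply: notin_disjoint_below aI' _].
Qed.

(** The sets describe a wall: the bottom labels are exits, [I] and [I'] are the crossings. In
    decreasing lists the crossings come first; being equally many, they are matched with each other,
    and the blocks a-1, ..., 0 and a, ..., 0 are matched from their tops. *)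
Lemma jump_same_card : #|I| = #|I'| ->
  [/\ jump minn (below a :|: I) (below a.+1 :|: I') = below a :|: jump minn I I',
      jump maxn (below a :|: I) (below a.+1 :|: I') = below a.+1 :|: jump maxn I I',
      [disjoint below a & jump minn I I'] & [disjoint below a.+1 & jump maxn I I']].
Proof.
move=> II'; split.
- apply/setP => i; rewrite jump_belowU // ?(ltnW an) // !inE.
  have [] := bounds i; move: II'; rewrite /=.
  move: #|[set j in I | (i < j)%N]| #|[set j in I' | (i < j)%N]| #|I| #|I'| (i \in I) (i \in I') => x x' c c' u u'.
  move: (nat_of_ord i) an; clear=> k; lia.
- apply/setP => i; rewrite jump_belowU // ?(ltnW an) // !inE.
  have [] := bounds i; move: II'; rewrite /=.
  move: #|[set j in I | (i < j)%N]| #|[set j in I' | (i < j)%N]| #|I| #|I'| (i \in I) (i \in I') => x x' c c' u u'.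
  move: (nat_of_ord i) an; clear=> k; lia.
- rewrite disjoint_subset; apply/fintype.subsetP => i; rewrite !inE.
  have [] := bounds i; move: II'; rewrite /=.
  move: #|[set j in I | (i < j)%N]| #|[set j in I' | (i < j)%N]| #|I| #|I'| (i \in I) (i \in I') => x x' c c' u u'.
  move: (nat_of_ord i) an; clear=> k; lia.
- rewrite disjoint_subset; apply/fintype.subsetP => i; rewrite !inE.
  have [] := bounds i; move: II'; rewrite /=.
  move: #|[set j in I | (i < j)%N]| #|[set j in I' | (i < j)%N]| #|I| #|I'| (i \in I) (i \in I') => x x' c c' u u'.
  move: (nat_of_ord i) an; clear=> k; lia.
Qed.

(** Now both lists have the same length, and the last crossing of [I] is matched with the top label
    [a] of the other bottom block. This crossing is at least [a], so the minimum takes [a] as an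
    exit and the maximum keeps the crossing: the bottom blocks are swapped compared with equal
    cardinalities. *)
Lemma jump_succ_card : #|I| = #|I'|.+1 ->
  [/\ jump minn (below a :|: I) (below a.+1 :|: I') = below a.+1 :|: jump minn I I',
      jump maxn (below a :|: I) (below a.+1 :|: I') = below a :|: jump maxn I I',
      [disjoint below a.+1 & jump minn I I'] & [disjoint below a & jump maxn I I']].
Proof.
move=> II'; split.
- apply/setP => i; rewrite jump_belowU // ?(ltnW an) // !inE.
  have [] := bounds i; move: II'; rewrite /=.
  move: #|[set j in I | (i < j)%N]| #|[set j in I' | (i < j)%N]| #|I| #|I'| (i \in I) (i \in I') => x x' c c' u u'.
  move: (nat_of_ord i) an; clear=> k; lia.
- apply/setP => i; rewrite jump_belowU // ?(ltnW an) // !inE.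
  have [] := bounds i; move: II'; rewrite /=.
  move: #|[set j in I | (i < j)%N]| #|[set j in I' | (i < j)%N]| #|I| #|I'| (i \in I) (i \in I') => x x' c c' u u'.
  move: (nat_of_ord i) an; clear=> k; lia.
- rewrite disjoint_subset; apply/fintype.subsetP => i; rewrite !inE.
  have [] := bounds i; move: II'; rewrite /=.
  move: #|[set j in I | (i < j)%N]| #|[set j in I' | (i < j)%N]| #|I| #|I'| (i \in I) (i \in I') => x x' c c' u u'.
  move: (nat_of_ord i) an; clear=> k; lia.
- rewrite disjoint_subset; apply/fintype.subsetP => i; rewrite !inE.
  have [] := bounds i; move: II'; rewrite /=.
  move: #|[set j in I | (i < j)%N]| #|[set j in I' | (i < j)%N]| #|I| #|I'| (i \in I) (i \in I') => x x' c c' u u'.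
  move: (nat_of_ord i) an; clear=> k; lia.
Qed.

End SplitCount.

Lemma jump_below c : c < n ->
  jump minn (below c.+1) (below c) = below c /\ jump maxn (below c.+1) (below c) = below c.+1.
Proof.
move=> cn; split; apply/setP => i; rewrite !inE !count_below //; lia.
Qed.

Lemma jump_top c : c < n ->
  jump minn (top c) (top c.+1) = top c /\ jump maxn (top c) (top c.+1) = top c.+1.
Proof.
by move=> cn; split; apply/setP => i; have := ltn_ord i; rewrite !inE !count_top //; lia.
Qed.

End IndexSets.

(** * Flows on concatenations *)

Section ConcatFlow.
Variables (n : nat) (N1 N2 : network n).
Hypothesis sink_out : forall (e : edge N1) i, tail e <> sink N1 i.
Hypothesis source_in : forall (e : edge N2) i, head e <> source N2 i.
Local Notation N := (concat N1 N2).
Local Notation inlV := (inl : vertex N1 -> vertex N).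
Local Notation glueV := (@glue n N1 N2 : vertex N2 -> vertex N).

Definition left_part (F : {set edge N}) : {set edge N1} := [set e | inl e \in F].
Definition right_part (F : {set edge N}) : {set edge N2} := [set e | inr e \in F].

Lemma card_edge_concat (P : pred (edge N)) :
  #|[set e | P e]| = #|[set e | P (inl e)]| + #|[set e | P (inr e)]|.
Proof.
have card (X : finType) (Q : pred X) : #|[set x | Q x]| = \sum_(x | Q x) 1.
  by rewrite -sum1_card; apply: eq_bigl => x; rewrite inE.
by rewrite !card (@big_sumType _ _ _ (edge N1) (edge N2)).
Qed.

Lemma glue_inr v : v \notin codom (source N2) -> exists v', glueV v = inr v'.
Proof. by move=> vN; exists (exist _ v vN); apply: glue_inner. Qed.

Lemma head_notin_source (e : edge N2) : head e \notin codom (source N2).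
Proof. by apply/codomP => -[i]; apply: source_in. Qed.

Lemma glue_neq_inl v u : v \notin codom (source N2) -> (glueV v == inl u) = false.
Proof. by case/glue_inr => v' ->. Qed.

Lemma glue_eqE u v : (glueV u == glueV v) = (u == v).
Proof. exact/inj_eq/glue_inj. Qed.

Lemma inl_eqE u v : (inlV u == inlV v) = (u == v).
Proof. by apply/inj_eq => ? ? []. Qed.

Lemma indeg_inl F v : indeg F (inlV v) = indeg (left_part F) v.
Proof.
rewrite /indeg card_edge_concat [X in _ + X]eq_card0 ?addn0.
  by apply: eq_card => e; rewrite !inE /= inl_eqE.
by move=> e; rewrite !inE /= glue_neq_inl ?andbF // head_notin_source.
Qed.

Lemma indeg_glue F v : v \notin codom (source N2) ->
  indeg F (glueV v) = indeg (right_part F) v.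
Proof.
move=> vN; rewrite /indeg card_edge_concat [X in X + _]eq_card0 ?add0n.
  by apply: eq_card => e; rewrite !inE /= glue_eqE.
by move=> e; rewrite !inE /= eq_sym glue_neq_inl ?andbF.
Qed.

Lemma outdeg_glue F v : v \notin codom (source N2) ->
  outdeg F (glueV v) = outdeg (right_part F) v.
Proof.
move=> vN; rewrite /outdeg card_edge_concat [X in X + _]eq_card0 ?add0n.
  by apply: eq_card => e; rewrite !inE /= glue_eqE.
by move=> e; rewrite !inE /= eq_sym glue_neq_inl ?andbF.
Qed.

Lemma outdeg_sink F i : outdeg F (inlV (sink N1 i)) = outdeg (right_part F) (source N2 i).
Proof.
rewrite -glue_source /outdeg card_edge_concat [X in X + _]eq_card0 ?add0n.
  by apply: eq_card => e; rewrite !inE /= glue_eqE.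
move=> e; rewrite !inE /= glue_source inl_eqE; case: eqP => [/sink_out //|_].
by rewrite andbF.
Qed.

Lemma outdeg_inl F v : v \notin codom (sink N1) ->
  outdeg F (inlV v) = outdeg (left_part F) v.
Proof.
move=> vN; rewrite /outdeg card_edge_concat [X in _ + X]eq_card0 ?addn0.
  by apply: eq_card => e; rewrite !inE /= inl_eqE.
move=> e; rewrite !inE /=; case: (boolP (tail e \in codom (source N2))) => [/codomP[i ->]|h].
  rewrite glue_source inl_eqE; case: eqP => [iv|_]; last by rewrite andbF.
  by rewrite -iv codom_f in vN.
by rewrite glue_neq_inl ?andbF.
Qed.

Lemma outdeg_left_sink F i : outdeg (left_part F) (sink N1 i) = 0.
Proof. by apply: eq_card0 => e; rewrite !inE; apply/negP => /andP[_ /eqP/sink_out]. Qed.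

Lemma indeg_right_source F i : indeg (right_part F) (source N2 i) = 0.
Proof. by apply: eq_card0 => e; rewrite !inE; apply/negP => /andP[_ /eqP/source_in]. Qed.

Lemma concat_vertexP (v : vertex N) : (exists u, v = inlV u) \/
  (exists2 u, u \notin codom (source N2) & v = glueV u).
Proof.
case: v => [u|[u uN]]; [by left; exists u | right; exists u => //].
by rewrite (glue_inner _ uN).
Qed.

Section Terminals.
Variables (F : {set edge N}) (S Y : {set vertex N1}) (Z : {set vertex N2}).
Hypothesis Znot : forall v, v \in Z -> v \notin codom (source N2).

Lemma inl_mem_inl u (A : {set vertex N1}) : (inlV u \in [set inlV v | v in A]) = (u \in A).
Proof. by apply: mem_imset => ? ? []. Qed.

Lemma glue_mem_inl u (A : {set vertex N1}) : u \notin codom (source N2) ->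
  (glueV u \in [set inlV v | v in A]) = false.
Proof. by move=> uN; apply/imsetP => -[v _ /eqP]; rewrite glue_neq_inl. Qed.

Lemma inl_mem_glue u : (inlV u \in [set glueV v | v in Z]) = false.
Proof. by apply/imsetP => -[v /Znot vN /eqP]; rewrite eq_sym glue_neq_inl. Qed.

Lemma glue_mem_glue u : (glueV u \in [set glueV v | v in Z]) = (u \in Z).
Proof. exact/mem_imset/glue_inj. Qed.

(** The crossing labels [I] are those at which the flow leaves the wall in the second factor.
    Capacity one at the wall makes every path either stop there or go on, whence the disjointness
    from [Y]. *)
Lemma flow_split :
    flow F [set inlV v | v in S] ([set inlV v | v in Y] :|: [set glueV v | v in Z]) ->
  exists I : {set 'I_n}, [/\ [disjoint Y & [set sink N1 i | i in I]],
    flow (left_part F) S (Y :|: [set sink N1 i | i in I]) &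
    flow (right_part F) [set source N2 i | i in I] Z].
Proof.
move=> fl; pose I := [set i | 0 < outdeg (right_part F) (source N2 i)]; exists I.
have flS i : outdeg (right_part F) (source N2 i) = (i \in I) :> nat /\
    (sink N1 i \in Y) + (i \in I) <= 1.
  have [] := fl (inlV (sink N1 i)); rewrite outdeg_sink in_setU inl_mem_inl inl_mem_glue orbF.
  rewrite inE; move: (outdeg _ _) (visits _ _ _) (_ \in Y); clear=> x y b; lia.
have sinkI i : (sink N1 i \in [set sink N1 j | j in I]) = (i \in I).
  exact/mem_imset/sink_inj.
have sourceI i : (source N2 i \in [set source N2 j | j in I]) = (i \in I).
  exact/mem_imset/source_inj.
split.
- rewrite disjoint_sym disjoint_subset; apply/fintype.subsetP => _ /imsetP[i iI ->].
  by have [_] := flS i; rewrite !inE in iI *; rewrite iI; case: (_ \in Y).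
- move=> v; have := fl (inlV v); rewrite /visits indeg_inl inl_mem_inl in_setU inl_mem_inl inl_mem_glue orbF.
  rewrite in_setU; case: (boolP (v \in codom (sink N1))) => [/codomP[i ->]|vN].
    rewrite outdeg_sink outdeg_left_sink sinkI add0n.
    have [-> ] := flS i; by case: (_ \in Y); case: (i \in I).
  rewrite outdeg_inl //; have -> : (v \in [set sink N1 i | i in I]) = false.
    by apply/imsetP => -[i _ vi]; rewrite vi codom_f in vN.
  by rewrite orbF.
- move=> v; case: (boolP (v \in codom (source N2))) => [/codomP[i ->]|vN].
    rewrite /visits indeg_right_source sourceI.
    have [-> _] := flS i; have -> : (source N2 i \in Z) = false.
      by apply/negP => /Znot; rewrite codom_f.
    by split; case: (i \in I).
  have := fl (glueV v); rewrite /visits indeg_glue // outdeg_glue // glue_mem_inl // in_setU glue_mem_inl // glue_mem_glue.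
  have -> : (v \in [set source N2 i | i in I]) = false.
    by apply/imsetP => -[i _ vi]; rewrite vi codom_f in vN.
  by [].
Qed.

Lemma flow_join (I : {set 'I_n}) : [disjoint Y & [set sink N1 i | i in I]] ->
    flow (left_part F) S (Y :|: [set sink N1 i | i in I]) ->
    flow (right_part F) [set source N2 i | i in I] Z ->
  flow F [set inlV v | v in S] ([set inlV v | v in Y] :|: [set glueV v | v in Z]).
Proof.
move=> disj fl1 fl2 v.
have sinkI i : (sink N1 i \in [set sink N1 j | j in I]) = (i \in I).
  exact/mem_imset/sink_inj.
have sourceI i : (source N2 i \in [set source N2 j | j in I]) = (i \in I).
  exact/mem_imset/source_inj.
case: (concat_vertexP v) => [[u ->]|[u uN ->]].
  rewrite /visits indeg_inl inl_mem_inl in_setU inl_mem_inl inl_mem_glue orbF.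
  have := fl1 u; rewrite /visits in_setU.
  case: (boolP (u \in codom (sink N1))) => [/codomP[i ->]|uN].
    rewrite outdeg_sink outdeg_left_sink sinkI add0n.
    have := fl2 (source N2 i); rewrite /visits indeg_right_source sourceI.
    have -> : (source N2 i \in Z) = false.
      by apply/negP => /Znot; rewrite codom_f.
    rewrite add0n addn0 => -[<- _].
    have := disjointFr disj (x := sink N1 i); rewrite sinkI.
    by case: (_ \in Y) => [/(_ isT) ->|_]; case: (i \in I).
  rewrite outdeg_inl //; have -> : (u \in [set sink N1 i | i in I]) = false.
    by apply/imsetP => -[i _ vi]; rewrite vi codom_f in uN.
  by rewrite orbF.
have := fl2 u; rewrite /visits indeg_glue // outdeg_glue // glue_mem_inl // in_setU glue_mem_inl // glue_mem_glue.
have -> : (u \in [set source N2 i | i in I]) = false.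
  by apply/imsetP => -[i _ vi]; rewrite vi codom_f in uN.
by [].
Qed.

End Terminals.
End ConcatFlow.

(** * Routes of the first factor inside a concatenation *)

Section Lift.
Variables (n : nat) (N1 N2 : network n).
Implicit Types p q : route N1.

Lemma lift_walk v es : walk (inl v : vertex (concat N1 N2)) (map inl es) = walk (v : vertex N1) es.
Proof.
by elim: es v => //= e es IH v; rewrite IH.
Qed.

Lemma lift_end p : route_end (lift_route N2 p) = inl (route_end p).
Proof.
by case: p => v es; rewrite /route_end /=; elim: es v => //= e es IH v; rewrite IH.
Qed.

Lemma lift_vertices p : route_vertices (lift_route N2 p) = map inl (route_vertices p).
Proof. by case: p => v es; rewrite /route_vertices /= -!map_comp. Qed.

Lemma lift_disjoint p q :
  vertex_disjoint (lift_route N2 p) (lift_route N2 q) = vertex_disjoint p q.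
Proof.
rewrite /vertex_disjoint !lift_vertices !disjoint_has; congr (~~ _).
by rewrite has_map; apply: eq_has => v; apply: mem_map => ? ? [].
Qed.

(** Every edge of [N2] ends beyond the common wall, so a route that ends in [N1] uses none of
    them. *)
Lemma unlift (p : route (concat N1 N2)) u :
    (forall (e : edge N2) i, head e <> source N2 i) ->
    walk p.1 p.2 -> route_end p = inl u ->
  exists q, lift_route N2 q = p.
Proof.
move=> source_in; case: p => v es /=; elim: es v => [|e es IH] v.
  by rewrite /route_end /= => _ ->; exists (u, [::]).
rewrite /= => /andP[/eqP ev w] pe.
have [[v1 es1] [v1E <-]] := IH _ w pe.
case: e ev w pe v1E => e ev w pe v1E; last first.
  have hN := head_notin_source source_in e.
  have /eqP := esym v1E; by rewrite /= (glue_neq_inl (N1 := N1) _ hN).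
by exists (tail e, e :: es1); rewrite -ev.
Qed.

Lemma unlift_seq (X : eqType) (f : route N1 -> X) (s : seq X) :
  {in s, forall x, exists p, f p = x} -> exists ps, map f ps = s.
Proof.
elim: s => [|x s IH] h; first by exists [::].
have [p px] := h x (mem_head _ _).
have [|ps pss] := IH; first by move=> y ys; apply: h; rewrite in_cons ys orbT.
by exists (p :: ps); rewrite /= px pss.
Qed.

End Lift.

Section WeightSum.
Variables (R : realType) (X : finType) (w : X -> \bar R).

(** Compared edge by edge, without any cancellation, so infinite weights do no harm. *)
Lemma sum_exchange (A B C D : {set X}) :
    (forall e, (e \in A) + (e \in B) = (e \in C) + (e \in D)) ->
  (\sum_(e in A) w e + \sum_(e in B) w e = \sum_(e in C) w e + \sum_(e in D) w e)%E.
Proof.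
move=> h; rewrite !(big_mkcond (fun e => e \in _)) -!big_split /=; apply: eq_bigr => e _.
have := h e; do 4!case: (e \in _) => //=; by rewrite ?adde0 ?add0e.
Qed.

End WeightSum.

(** * Flows through three concatenated networks *)

Section ThreeFactors.
Variables (R : realType) (n : nat) (Pi1 Pi2 Pi3 : planar_network R n).
Local Notation N12 := (concat Pi1 Pi2).
Local Notation N := (concat (concat Pi1 Pi2) Pi3).
Implicit Types (F : {set edge N}) (I X : {set 'I_n}).

Lemma planar_source_in (Pi : planar_network R n) (e : edge Pi) i : head e <> source Pi i.
Proof.
move=> he; have := source_in0 i [set e]; apply/eqP; rewrite -lt0n.
by apply/indeg_gt0; exists e; rewrite ?set11.
Qed.

Lemma planar_sink_out (Pi : planar_network R n) (e : edge Pi) i : tail e <> sink Pi i.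
Proof.
move=> he; have := sink_out0 i [set e]; apply/eqP; rewrite -lt0n.
by apply/outdeg_gt0; exists e; rewrite ?set11.
Qed.

Lemma planar_sink_notin_source (Pi : planar_network R n) i : sink Pi i \notin codom (source Pi).
Proof. by apply/codomP => -[j /eqP]; rewrite eq_sym (negPf (source_neq_sink Pi j i)). Qed.

Lemma concat_sink_out (e : edge N12) i : tail e <> sink N12 i.
Proof.
case: e => e /=.
  by move/eqP; rewrite eq_sym glue_neq_inl // planar_sink_notin_source.
by move/glue_inj; apply: planar_sink_out.
Qed.

Definition source3 i : vertex N := inl (inl (source Pi1 i)).

Definition terminal (x : 'I_n + 'I_n + 'I_n) : vertex N :=
  match x with
  | inl (inl i) => inl (inl (sink Pi1 i))
  | inl (inr i) => inl (glue Pi1 (sink Pi2 i))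
  | inr i => glue N12 (sink Pi3 i)
  end.

Lemma terminal_inj : injective terminal.
Proof.
have g2 i : exists v, glue Pi1 (sink Pi2 i) = inr v.
  exact/glue_inr/planar_sink_notin_source.
have g3 i : exists v, glue N12 (sink Pi3 i) = inr v.
  exact/glue_inr/planar_sink_notin_source.
move=> [[i|i]|i] [[j|j]|j] /=.
- by case=> /sink_inj ->.
- by have [v ->] := g2 j.
- by have [v ->] := g3 j.
- by have [v ->] := g2 i.
- by case=> /glue_inj/sink_inj ->.
- by have [v ->] := g3 j.
- by have [v ->] := g3 i.
- by have [v ->] := g3 i.
- by move=> /(@glue_inj n N12 Pi3) /sink_inj ->.
Qed.

(** Terminals are named by a wall and a label. Since [terminal] is injective, moving one terminal
    between two flows becomes set arithmetic on these names. *)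
Definition exits X1 X2 X3 : {set 'I_n + 'I_n + 'I_n} :=
  [set x | match x with inl (inl i) => i \in X1 | inl (inr i) => i \in X2 | inr i => i \in X3 end].

Definition flow3 F I X1 X2 X3 :=
  flow F [set source3 i | i in I] [set terminal x | x in exits X1 X2 X3].

Lemma sourcesE I : [set source3 i | i in I] =
  [set (inl v : vertex N) | v in [set (inl v : vertex N12) | v in [set source Pi1 i | i in I]]].
Proof. by rewrite -!imset_comp. Qed.

Lemma terminalsE X1 X2 X3 : [set terminal x | x in exits X1 X2 X3] =
  [set (inl v : vertex N) | v in [set (inl v : vertex N12) | v in [set sink Pi1 i | i in X1]] :|:
    [set glue Pi1 v | v in [set sink Pi2 i | i in X2]]] :|:
  [set glue N12 v | v in [set sink Pi3 i | i in X3]].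
Proof.
rewrite imsetU -!imset_comp; apply/setP => v; rewrite !in_setU.
apply/imsetP/orP => [[[[i|i]|i]]|].
- by rewrite inE => iX ->; left; apply/orP; left; apply/imsetP; exists i.
- by rewrite inE => iX ->; left; apply/orP; right; apply/imsetP; exists i.
- by rewrite inE => iX ->; right; apply/imsetP; exists i.
case=> [/orP[]|] /imsetP[i iX ->].
- by exists (inl (inl i)); rewrite ?inE.
- by exists (inl (inr i)); rewrite ?inE.
- by exists (inr i); rewrite ?inE.
Qed.

Definition part1 F := left_part (left_part F).
Definition part2 F := right_part (left_part F).
Definition part3 F := right_part F.

Lemma flow3_split F I X1 X2 X3 : flow3 F I X1 X2 X3 ->
  exists I2 I3, [/\ [disjoint X1 & I2] /\ [disjoint X2 & I3],
    flow (part1 F) [set source Pi1 i | i in I] [set sink Pi1 i | i in X1 :|: I2],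
    flow (part2 F) [set source Pi2 i | i in I2] [set sink Pi2 i | i in X2 :|: I3] &
    flow (part3 F) [set source Pi3 i | i in I3] [set sink Pi3 i | i in X3]].
Proof.
rewrite /flow3 sourcesE terminalsE => fl.
have Znot (Pi : planar_network R n) X v : v \in [set sink Pi i | i in X] -> v \notin codom (source Pi).
  by move=> /imsetP[i _ ->]; apply: planar_sink_notin_source.
have [I3 [d3 fl12 fl3]] := flow_split concat_sink_out (@planar_source_in Pi3) (@Znot Pi3 X3) fl.
have E : [set (inl v : vertex N12) | v in [set sink Pi1 i | i in X1]] :|:
    [set glue Pi1 v | v in [set sink Pi2 i | i in X2]] :|: [set sink N12 i | i in I3] =
    [set (inl v : vertex N12) | v in [set sink Pi1 i | i in X1]] :|:
    [set glue Pi1 v | v in [set sink Pi2 i | i in X2 :|: I3]].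
  by rewrite -setUA !imsetU; congr (_ :|: (_ :|: _)); rewrite -imset_comp.
rewrite E in fl12.
have [I2 [d2 fl1 fl2]] := flow_split (@planar_sink_out Pi1) (@planar_source_in Pi2) (@Znot Pi2 _) fl12.
exists I2, I3; split=> //; last by rewrite imsetU.
split; rewrite disjoint_subset; apply/fintype.subsetP => i iX; rewrite !inE; apply/negP => iI.
  have := disjointFr d2 (imset_f (sink Pi1) iX); by rewrite imset_f.
have iY : sink N12 i \in [set (inl v : vertex N12) | v in [set sink Pi1 i | i in X1]] :|:
    [set glue Pi1 v | v in [set sink Pi2 i | i in X2]].
  by rewrite in_setU; apply/orP; right; apply/imset_f/imset_f.
by have := disjointFr d3 iY; rewrite imset_f.
Qed.

Lemma flow3_join F I I2 I3 X1 X2 X3 : [disjoint X1 & I2] -> [disjoint X2 & I3] ->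
    flow (part1 F) [set source Pi1 i | i in I] [set sink Pi1 i | i in X1 :|: I2] ->
    flow (part2 F) [set source Pi2 i | i in I2] [set sink Pi2 i | i in X2 :|: I3] ->
    flow (part3 F) [set source Pi3 i | i in I3] [set sink Pi3 i | i in X3] ->
  flow3 F I X1 X2 X3.
Proof.
move=> d1 d2 fl1 fl2 fl3; rewrite /flow3 sourcesE terminalsE.
have Znot (Pi : planar_network R n) X v : v \in [set sink Pi i | i in X] -> v \notin codom (source Pi).
  by move=> /imsetP[i _ ->]; apply: planar_sink_notin_source.
have E : [set (inl v : vertex N12) | v in [set sink Pi1 i | i in X1]] :|:
    [set glue Pi1 v | v in [set sink Pi2 i | i in X2]] :|: [set sink N12 i | i in I3] =
    [set (inl v : vertex N12) | v in [set sink Pi1 i | i in X1]] :|: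
    [set glue Pi1 v | v in [set sink Pi2 i | i in X2 :|: I3]].
  by rewrite -setUA !imsetU; congr (_ :|: (_ :|: _)); rewrite -imset_comp.
apply: (flow_join concat_sink_out (@planar_source_in Pi3) (@Znot Pi3 X3) (I := I3)) fl3.
  rewrite disjoint_sym disjoint_subset; apply/fintype.subsetP => _ /imsetP[i iI ->].
  rewrite !inE; apply/negP => /orP[] /imsetP[v].
    move=> _ /eqP; by rewrite glue_neq_inl // planar_sink_notin_source.
  by move=> /imsetP[j jX ->] /glue_inj/sink_inj ij; have := disjointFr d2 jX; rewrite -ij iI.
rewrite E; apply: (flow_join (@planar_sink_out Pi1) (@planar_source_in Pi2) (@Znot Pi2 _) (I := I2)) fl2.
  rewrite disjoint_subset; apply/fintype.subsetP => _ /imsetP[i iX ->].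
  by rewrite !inE; apply/imsetP => -[j jI /sink_inj ij]; have := disjointFr d1 iX; rewrite ij jI.
by rewrite -imsetU.
Qed.

End ThreeFactors.

(** * Flows and the values m *)

Lemma concat_ranked n (N1 N2 : network n) rk1 rk2 :
    (forall (e : edge N2) i, head e <> source N2 i) ->
    @ranked n N1 rk1 -> @ranked n N2 rk2 ->
  exists rk, @ranked n (concat N1 N2) rk.
Proof.
move=> source_in r1 r2; pose M := (\max_v rk1 v).+1.
exists (fun v => match v with inl v1 => rk1 v1 | inr v2 => M + rk2 (val v2) end).
case=> e /=; first exact: r1.
rewrite (glue_inner _ (head_notin_source source_in e)) /=.
case: (boolP (tail e \in codom (source N2))) => [/codomP[i ->]|tN].
  by rewrite glue_source; have := leq_bigmax (F := rk1) (sink N1 i); rewrite /M; lia.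
by rewrite (glue_inner _ tN) /= ltn_add2l r2.
Qed.

Section Maxima3.
Variables (R : realType) (n : nat) (Pi1 Pi2 Pi3 : planar_network R n).
Local Notation N := (concat (concat Pi1 Pi2) Pi3).
Local Notation C := (Then (Then (Single Pi1) Pi2) Pi3).
Variable w : @weighting R n N.
Implicit Types (F : {set edge N}).

Lemma total_ranked : exists rk, @ranked n N rk.
Proof.
have [rk r12] := concat_ranked (@planar_source_in R n Pi2) (@column_ranked _ _ Pi1) (@column_ranked _ _ Pi2).
exact: concat_ranked (@planar_source_in R n Pi3) r12 (@column_ranked _ _ Pi3).
Qed.

Local Notation W F := (\sum_(e in F) w e)%E.

Lemma multi_GZ_flow (a b c : nat) : @multi_GZ R n C w -> a + b + c <= n ->
  exists2 F, flow3 F (top n (a + b + c)) (below n a) (below n b) (below n c) &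
    W F = @max_weight R n C w [:: a; b; c].
Proof.
move=> gz abc; have sumE : sumn [:: a; b; c] = a + b + c by rewrite /= addn0 addnA.
have [|[[p1 p2] p3]] := gz [:: a; b; c] erefl; first by rewrite sumE.
rewrite sumE => -[mm opt src [[/= snk1 snk2] snk3]].
have maxE : @max_weight R n C w [:: a; b; c] = @tuple_weight R n C w (p1, p2, p3).
  apply: le_anti; apply/andP; split.
    by apply: ub_ereal_sup => _ [Q Qmm <-]; apply: opt.
  by apply: ereal_sup_ubound; exists (p1, p2, p3).
rewrite maxE; case: mm => /= -[/and3P[_ /allP m1 _] /and3P[_ /allP m2 _] _] /and3P[_ /allP m3 _] dj.
set rs := map _ _ ++ p3 in dj.
have [rk rkP] := total_ranked.
have rs_ok : all (fun p : route N => walk p.1 p.2 && (p.1 \in codom (source N))) rs.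
  rewrite all_cat map_cat all_cat -map_comp !all_map; apply/andP; split.
    apply/andP; split; apply/allP => -[v es] /= pp.
      have /and3P[/= wv /codomP[i vi] _] := m1 _ pp.
      apply/andP; split; [by rewrite !lift_walk; exact: wv | by rewrite vi; apply/codomP; exists i].
    have /and3P[/= wv /codomP[i vi] _] := m2 _ pp.
    apply/andP; split; [by rewrite lift_walk; exact: wv | by rewrite vi; apply/codomP; exists i].
  by apply/allP => p /m3 /and3P[-> ->].
have rs_walk : all (fun p : route N => walk p.1 p.2) rs.
  by apply/allP => p /(allP rs_ok) /andP[].
have [F [fl FE _]] := routes_flow rkP rs_walk dj.
exists F; last first.
  by rewrite -big_enum (perm_big _ FE) big_flatten big_map.
move: fl; rewrite /flow3.
have <- : [set x in map fst rs] = [set source3 Pi1 Pi2 Pi3 i | i in top n (a + b + c)].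
  apply/setP => v; rewrite inE; apply/idP/imsetP => [vrs|[i]].
    have /mapP[p prs vp] := vrs; have /andP[_ /codomP[i pi]] := allP rs_ok p prs.
    exists i; last by rewrite vp pi.
    by rewrite /top -src inE; rewrite -pi -vp.
  by rewrite /top -src inE => ? ->.
suff <- : [set x in map (@route_end n N) rs] =
    [set terminal Pi1 Pi2 Pi3 x | x in exits (below n a) (below n b) (below n c)] by [].
have end1 (p : route Pi1) : route_end (lift_route Pi3 (lift_route Pi2 p)) = inl (inl (route_end p)).
  by rewrite !lift_end.
apply/setP => v; rewrite inE /rs !map_cat -!map_comp !mem_cat; apply/idP/imsetP.
  move=> /orP[/orP[]|] /mapP[p pp ->].
  - have /and3P[_ _ /codomP[i ip]] := m1 p pp; exists (inl (inl i)); last by rewrite /= end1 ip.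
    by rewrite inE /below -snk1 inE -ip map_f.
  - have /and3P[_ _ /codomP[i ip]] := m2 p pp; exists (inl (inr i)); last by rewrite /= lift_end ip.
    by rewrite inE /below -snk2 inE -ip map_f.
  - have /and3P[_ _ /codomP[i ip]] := m3 p pp; exists (inr i); last by rewrite ip.
    by rewrite inE /below -snk3 inE -ip map_f.
move=> [[[i|i]|i]]; rewrite inE /below -?snk1 -?snk2 -?snk3 inE => /mapP[p pp ip] ->.
- apply/orP; left; apply/orP; left; apply/mapP; exists p => //=; by rewrite end1 -ip.
- apply/orP; left; apply/orP; right; apply/mapP; exists p => //=; by rewrite lift_end -ip.
- by apply/orP; right; apply/mapP; exists p.
Qed.

(** The maximum runs over multipaths from arbitrary sources, so every flow with these exits
    competes. The work lies in cutting the flow into routes and sorting them by the wall where they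
    end. *)
Lemma flow_max_weight F I (a b c : nat) : a <= n -> b <= n -> c <= n ->
  flow3 F I (below n a) (below n b) (below n c) -> (W F <= @max_weight R n C w [:: a; b; c])%E.
Proof.
move=> an bn cn fl; have [rk rkP] := total_ranked.
have [r [rw _ rd rT rF]] := flow_routes rkP fl.
move: fl rw rd rT rF; set S := [set source3 _ _ _ i | i in I].
set T := [set _ | x in exits _ _ _] => fl rw rd rT rF.
(* The routes come indexed by their sources, while the tuple groups them by their ends; [st] sends
   an end back to its source. Outside [T] the witness is a dummy that makes [st] a total
   function. *)
have start t : exists s, t \in T -> s \in S /\ route_end (s, r s) = t.
  case: (boolP (t \in T)) => [|_]; last by exists t.
  by rewrite -rT => /imsetP[s sS ->]; exists s.
have {start} [st stP] := choice start.
pose Q t : route N := (st t, r (st t)).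
have Qwalk t : t \in T -> walk (Q t).1 (Q t).2 by move=> /stP[/rw].
have Qend t : t \in T -> route_end (Q t) = t by move=> /stP[].
have Qstart t : t \in T -> (Q t).1 \in S by move=> /stP[].
have Qdisj t u : t \in T -> u \in T -> t != u -> vertex_disjoint (Q t) (Q u).
  move=> tT uT tu; apply: rd; rewrite ?Qstart //; apply: contra tu => /eqP stu.
  by rewrite -(Qend t tT) -(Qend u uT) /Q stu.
pose term x := terminal Pi1 Pi2 Pi3 x.
pose t1 := [seq term (inl (inl i)) | i <- enum (below n a)].
pose t2 := [seq term (inl (inr i)) | i <- enum (below n b)].
pose t3 := [seq term (inr i) | i <- enum (below n c)].
have mem1 t : t \in t1 -> t \in T /\ exists i, t = inl (inl (sink Pi1 i)).
  move=> /mapP[i]; rewrite mem_enum => ia ->; split; last by exists i.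
  by apply: imset_f; rewrite inE.
have mem2 t : t \in t2 -> t \in T /\ exists i, t = inl (glue Pi1 (sink Pi2 i)).
  move=> /mapP[i]; rewrite mem_enum => ia ->; split; last by exists i.
  by apply: imset_f; rewrite inE.
have mem3 t : t \in t3 -> t \in T /\ exists i, t = sink N i.
  move=> /mapP[i]; rewrite mem_enum => ia ->; split; last by exists i.
  by apply: imset_f; rewrite inE.
have tsT t : (t \in t1 ++ t2 ++ t3) = (t \in T).
  rewrite !mem_cat; apply/idP/idP; first by move=> /or3P[/mem1|/mem2|/mem3] [].
  move=> /imsetP[[[i|i]|i]]; rewrite inE => ix ->; apply/or3P.
  - by apply: Or31; apply/mapP; exists i; rewrite ?mem_enum.
  - by apply: Or32; apply/mapP; exists i; rewrite ?mem_enum.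
  - by apply: Or33; apply/mapP; exists i; rewrite ?mem_enum.
have ts_uniq : uniq (t1 ++ t2 ++ t3).
  have -> : t1 ++ t2 ++ t3 = map term ([seq inl (inl i) | i <- enum (below n a)] ++
      [seq inl (inr i) | i <- enum (below n b)] ++ [seq inr i | i <- enum (below n c)]).
    by rewrite !map_cat -!map_comp.
  rewrite map_inj_uniq; last exact: terminal_inj.
  rewrite !cat_uniq !map_inj_uniq ?enum_uniq //=; try by move=> ? ? [].
  rewrite andbT; apply/andP; split.
    by apply/hasPn => x; rewrite mem_cat => /orP[] /mapP[j _ ->]; apply/mapP => -[].
  by apply/hasPn => x /mapP[j _ ->]; apply/mapP => -[].
(* Paths that stop at an inner wall must be given in the shorter composite network; those of the
   first wall are pulled back twice, by way of [p1']. *)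
have [p2 p2E] : exists p2, map (@lift_route n (concat Pi1 Pi2) Pi3) p2 = map Q t2.
  apply: unlift_seq => _ /mapP[t /mem2[tT [i ti]] ->].
  apply: (@unlift n (concat Pi1 Pi2) Pi3 _ (glue Pi1 (sink Pi2 i))); [exact: planar_source_in | exact: Qwalk | by rewrite Qend].
have [p1' p1'E] : exists p1', map (@lift_route n (concat Pi1 Pi2) Pi3) p1' = map Q t1.
  apply: unlift_seq => _ /mapP[t /mem1[tT [i ti]] ->].
  apply: (@unlift n (concat Pi1 Pi2) Pi3 _ (inl (sink Pi1 i))); [exact: planar_source_in | exact: Qwalk | by rewrite Qend].
have lifted ps ts q : map (@lift_route n (concat Pi1 Pi2) Pi3) ps = map Q ts -> q \in ps ->
    exists2 t, t \in ts & lift_route Pi3 q = Q t.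
  by move=> pE qps; have := map_f (@lift_route n (concat Pi1 Pi2) Pi3) qps; rewrite pE => /mapP.
have liftW q t : t \in T -> lift_route Pi3 q = Q t ->
    [/\ walk q.1 q.2, inl q.1 \in S & inl (route_end q) = t].
  move=> tT qt; have := Qwalk t tT; have := Qstart t tT; have := Qend t tT.
  by rewrite -qt lift_end /= lift_walk.
have [p1 p1E] : exists p1, map (@lift_route n Pi1 Pi2) p1 = p1'.
  apply: unlift_seq => q /(lifted _ _ _ p1'E)[t /mem1[tT [i ti]] qt].
  have [qw _ qe] := liftW q t tT qt.
  by apply: (@unlift n Pi1 Pi2 _ (sink Pi1 i)) => //; [exact: planar_source_in | move: qe; rewrite ti => -[]].
have routesE : @routes n C (p1, p2, map Q t3) = map Q (t1 ++ t2 ++ t3).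
  by rewrite /= p1E map_cat p1'E p2E !map_cat catA.
have pw : pairwise (@vertex_disjoint n N) (map Q (t1 ++ t2 ++ t3)).
  rewrite pairwise_map; apply: (sub_in_pairwise (P := mem T) (r := fun x y => x != y)) => [t u||].
  - exact: Qdisj.
  - by apply/allP => t; rewrite tsT.
  - by rewrite -uniq_pairwise.
have startP v : inl (inl v) \in S -> v \in codom (source Pi1).
  by move=> /imsetP[i _ [->]]; rewrite codom_f.
have mm : @is_multimultipath n C [:: a; b; c] (p1, p2, map Q t3).
  split; last by rewrite routesE.
    split.
    - apply/and3P; split.
      + rewrite -(size_map (@lift_route n Pi1 Pi2)) p1E -(size_map (@lift_route n (concat Pi1 Pi2) Pi3)) p1'E.
        by rewrite !size_map -cardE card_below.
      + apply/allP => q qp1.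
        have [|t /mem1[tT [i ti]] qt] := lifted _ _ (lift_route Pi2 q) p1'E.
          by rewrite -p1E map_f.
        have [qw qs] := liftW _ t tT qt; rewrite ti lift_end => -[qe].
        apply/and3P; split; last by rewrite qe codom_f.
          by move: qw; rewrite /= lift_walk.
        exact: startP.
      + move: pw; rewrite map_cat pairwise_cat -p1'E -p1E -map_comp pairwise_map => /and3P[_ + _].
        by apply: sub_pairwise => p q; rewrite /relpre /= !lift_disjoint.
    - apply/and3P; split.
      + by rewrite -(size_map (@lift_route n (concat Pi1 Pi2) Pi3)) p2E !size_map -cardE card_below.
      + apply/allP => q qp2; have [t /mem2[tT [i ti]] qt] := lifted _ _ q p2E qp2.
        have [qw qs] := liftW _ t tT qt; rewrite ti => -[qe].
        apply/and3P; split; [exact: qw | | by rewrite qe; apply/codomP; exists i].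
        by have /imsetP[j _ [->]] := qs; apply/codomP; exists j.
      + move: pw; rewrite !map_cat !pairwise_cat -p2E => /and5P[_ _ _ + _].
        by rewrite pairwise_map; apply: sub_pairwise => p q; rewrite /relpre /= !lift_disjoint.
    - rewrite /= p1E; move: pw; rewrite catA map_cat pairwise_cat map_cat -p1'E -p2E -map_cat.
      move=> /and3P[_ + _].
      by rewrite pairwise_map; apply: sub_pairwise => p q; rewrite /relpre /= !lift_disjoint.
  apply/and3P; split.
  - by rewrite !size_map -cardE card_below.
  - apply/allP => _ /mapP[t /mem3[tT [i ti]] ->].
    apply/and3P; split; [exact: Qwalk | | by rewrite Qend // ti codom_f].
    by have /imsetP[j _ ->] := Qstart t tT; apply/codomP; exists j.
  - by move: pw; rewrite !map_cat !pairwise_cat => /and5P[].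
apply: ereal_sup_ubound; exists (p1, p2, map Q t3) => //.
rewrite /tuple_weight routesE big_map /Q /=.
rewrite -big_enum -(perm_big _ rF) big_flatten big_map /=.
(* Passes from a sum over ends to a sum over sources: [st] is a bijection, because disjoint routes
   have different ends. *)
have -> : (\sum_(t <- t1 ++ t2 ++ t3) \sum_(e <- r (st t)) w e)%E =
    (\sum_(s <- map st (t1 ++ t2 ++ t3)) \sum_(e <- r s) w e)%E by rewrite big_map.
apply: perm_big; apply: uniq_perm; rewrite ?enum_uniq //.
  rewrite map_inj_in_uniq // => t u; rewrite !tsT => tT uT tu.
  by rewrite -(Qend t tT) -(Qend u uT) /Q tu.
move=> s; rewrite mem_enum; apply/mapP/idP => [[t]|sS].
  by rewrite tsT => tT ->; exact: Qstart.
have eT : route_end (s, r s) \in T by rewrite -rT imset_f.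
exists (route_end (s, r s)); first by rewrite tsT.
apply/eqP/negPn/negP => neq; have [sS' se] := stP _ eT.
have := disjointFr (rd _ _ sS sS' neq) (mem_last _ _).
by rewrite -[last _ _]/(route_end (s, r s)) -{1}se [_ \in _]mem_last.
Qed.

End Maxima3.

(** * The three inequalities *)

Section ExitSets.
Variable n : nat.
Implicit Types x y : 'I_n.

Lemma exits_diff a b c a' b' c' (z : 'I_n + 'I_n + 'I_n) :
    z \in exits (below n a') (below n b') (below n c') :\: exits (below n a) (below n b) (below n c) ->
  match z with
  | inl (inl x) => a <= x < a' | inl (inr x) => b <= x < b' | inr x => c <= x < c'
  end.
Proof. by case: z => [[x|x]|x]; rewrite !inE -leqNgt. Qed.

(** A numerical code, so that equality of exits is decided by arithmetic. *)
Definition exit_label (z : 'I_n + 'I_n + 'I_n) : nat * nat :=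
  match z with inl (inl x) => (0, val x) | inl (inr x) => (1, val x) | inr x => (2, val x) end.

Lemma exit_eqE z z' : (z == z') = (exit_label z == exit_label z').
Proof.
apply/eqP/eqP => [-> //|].
by case: z z' => [[x|x]|x] [[y|y]|y] //= [] /val_inj ->.
Qed.

Lemma exitsU1 a b c p q r (z : 'I_n + 'I_n + 'I_n) :
    match z with
    | inl (inl x) => [/\ x = a :> nat, p = a.+1, q = b & r = c]
    | inl (inr x) => [/\ x = b :> nat, p = a, q = b.+1 & r = c]
    | inr x => [/\ x = c :> nat, p = a, q = b & r = c.+1]
    end ->
  z |: exits (below n a) (below n b) (below n c) = exits (below n p) (below n q) (below n r).
Proof.
move=> zE; apply/setP => y; rewrite in_setU1 exit_eqE.
case: z y zE => [[x|x]|x] [[y|y]|y] [xE -> -> ->]; rewrite !inE /= ?xpair_eqE //= xE; lia.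
Qed.

Lemma exitsD1 a b c p q r (z : 'I_n + 'I_n + 'I_n) :
    match z with
    | inl (inl x) => [/\ x = p :> nat, a = p.+1, b = q & c = r]
    | inl (inr x) => [/\ x = q :> nat, a = p, b = q.+1 & c = r]
    | inr x => [/\ x = r :> nat, a = p, b = q & c = r.+1]
    end ->
  exits (below n a) (below n b) (below n c) :\ z = exits (below n p) (below n q) (below n r).
Proof.
move=> zE; apply/setP => y; rewrite in_setD1 exit_eqE.
case: z y zE => [[x|x]|x] [[y|y]|y] [xE -> -> ->]; rewrite !inE /= ?xpair_eqE //= xE; lia.
Qed.

End ExitSets.

Section FlowInequalities.
Variables (R : realType) (n : nat) (Pi1 Pi2 Pi3 : planar_network R n).
Local Notation N := (concat (concat Pi1 Pi2) Pi3).
Implicit Types (F : {set edge N}).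

Lemma card_top a : a <= n -> #|top n a| = a.
Proof.
move=> an; rewrite (@count_ord n (fun k => n - a <= k)%N).
suff h m : \sum_(0 <= k < m) ((n - a <= k)%N : nat) = m - (n - a) by rewrite h; lia.
by elim: m => [|m IH]; [rewrite big_geq //; lia | rewrite big_nat_recr //= IH; lia].
Qed.

Lemma flow_card_index (Pi : planar_network R n) (F : {set edge Pi}) (I J : {set 'I_n}) :
  flow F [set source Pi i | i in I] [set sink Pi i | i in J] -> #|I| = #|J|.
Proof.
move=> /flow_card; rewrite !card_imset //; [exact: sink_inj | exact: source_inj].
Qed.

Definition merge (A1 : {set edge Pi1}) (A2 : {set edge Pi2}) (A3 : {set edge Pi3}) : {set edge N} :=
  [set e | match e with inl (inl e1) => e1 \in A1 | inl (inr e2) => e2 \in A2 | inr e3 => e3 \in A3 end].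

Lemma merge_parts A1 A2 A3 :
  [/\ part1 (merge A1 A2 A3) = A1, part2 (merge A1 A2 A3) = A2 & part3 (merge A1 A2 A3) = A3].
Proof. by split; apply/setP => e; rewrite !inE. Qed.

(** In each factor all routes run from side to side, so the envelopes exist there. At an inner wall
    the exits stay disjoint from [jump] of the crossings, which serves both as terminals of one
    piece and as sources of the next; hence the pieces join. *)
Lemma flow3_lattice F F' i j k : i + j + k + 2 <= n ->
    flow3 F (top n (i + j + k).+1) (below n i) (below n j) (below n k.+1) ->
    flow3 F' (top n (i + j + k).+2) (below n i.+1) (below n j.+1) (below n k) ->
  exists A B, [/\ flow3 A (top n (i + j + k).+1) (below n i) (below n j.+1) (below n k),
    flow3 B (top n (i + j + k).+2) (below n i.+1) (below n j) (below n k.+1) &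
    forall e, (e \in A) + (e \in B) = (e \in F) + (e \in F')].
Proof.
move=> ijk /flow3_split[I2 [I3 [[d2 d3] fl1 fl2 fl3]]] /flow3_split[I2' [I3' [[d2' d3'] fl1' fl2' fl3']]].
have cardU a (I : {set 'I_n}) : a <= n -> [disjoint below n a & I] -> #|below n a :|: I| = a + #|I|.
  by move=> an; rewrite -leq_card_setU => /eqP->; rewrite card_below.
(* Both flows have j+k+1 paths beyond the first wall. *)
have I2I2' : #|I2| = #|I2'|.
  have := flow_card_index fl1; have := flow_card_index fl1'.
  rewrite !cardU ?card_top //; lia.
(* Beyond the second wall [F] has k+1 paths and [F'] has k; this difference swaps the exits j and
   j+1 between the envelopes. *)
have I3I3' : #|I3| = #|I3'|.+1.
  have := flow_card_index fl3; have := flow_card_index fl3'; rewrite !card_below; lia.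
have [lt_i lt_j lt_k lt_N] : [/\ i < n, j < n, k < n & (i + j + k).+1 < n] by split; lia.
have [min1 max1 dmin1 dmax1] := jump_same_card lt_i d2 d2' I2I2'.
have [min2 max2 dmin2 dmax2] := jump_succ_card lt_j d3 d3' I3I3'.
have [min3 max3] := jump_below lt_k; have [min0 max0] := jump_top lt_N.
have [A1 [B1 [flA1 flB1 AB1]]] := flow_lattice fl1 fl1'.
have [A2 [B2 [flA2 flB2 AB2]]] := flow_lattice fl2 fl2'.
have [A3 [B3 [flA3 flB3 AB3]]] := flow_lattice fl3 fl3'.
rewrite min0 min1 in flA1; rewrite max0 max1 in flB1.
rewrite min2 in flA2; rewrite max2 in flB2; rewrite min3 in flA3; rewrite max3 in flB3.
exists (merge A1 A2 A3), (merge B1 B2 B3); split.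
- have [E1 E2 E3] := merge_parts A1 A2 A3.
  by apply: flow3_join dmin1 dmin2 _ _ _; rewrite ?E1 ?E2 ?E3.
- have [E1 E2 E3] := merge_parts B1 B2 B3.
  by apply: flow3_join dmax1 dmax2 _ _ _; rewrite ?E1 ?E2 ?E3.
- case=> [[e|e]|e]; rewrite [_ \in merge _ _ _]inE [_ \in merge B1 _ _]inE.
  + by rewrite AB1 !inE.
  + by rewrite AB2 !inE.
  + by rewrite AB3 !inE.
Qed.

Lemma flow3_exchange F F' m a b c a' b' c' : m < n ->
    flow3 F (top n m) (below n a) (below n b) (below n c) ->
    flow3 F' (top n m.+1) (below n a') (below n b') (below n c') ->
  let E := exits (below n a) (below n b) (below n c) in
  let E' := exits (below n a') (below n b') (below n c') in
  exists x A B, [/\ x \in E' :\: E,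
    flow A [set source3 Pi1 Pi2 Pi3 i | i in top n m.+1] [set terminal Pi1 Pi2 Pi3 y | y in x |: E],
    flow B [set source3 Pi1 Pi2 Pi3 i | i in top n m] [set terminal Pi1 Pi2 Pi3 y | y in E' :\ x] &
    forall e, (e \in A) + (e \in B) = (e \in F) + (e \in F')].
Proof.
move=> mn fl fl' E E'; have lt_s : n - m.+1 < n by lia.
have source3_inj : injective (@source3 R n Pi1 Pi2 Pi3) by move=> i j [/source_inj].
(* The lowest of the top m+1 sources, the only one at which the two flows do not both start. *)
pose s := source3 Pi1 Pi2 Pi3 (Ordinal lt_s).
have sS : s \notin [set source3 Pi1 Pi2 Pi3 i | i in top n m].
  by apply/imsetP => -[i]; rewrite inE => im /source3_inj iE; rewrite -iE /= in im; lia.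
have topS : [set source3 Pi1 Pi2 Pi3 i | i in top n m.+1] =
    s |: [set source3 Pi1 Pi2 Pi3 i | i in top n m].
  rewrite -imsetU1; suff -> : top n m.+1 = Ordinal lt_s |: top n m by [].
  by apply/setP => i; rewrite !inE -val_eqE /=; lia.
rewrite /flow3 topS in fl'.
have [t [A [B [tT flA flB AB]]]] := flow_exchange sS fl fl'.
have /setDP[/imsetP[x xE' tx] tE] := tT; rewrite {t}tx in tT tE flA flB.
exists x, A, B; split=> //.
- by rewrite in_setD xE' andbT; apply: contra tE => xE; apply: imset_f.
- by rewrite topS imsetU1.
- suff <- : [set terminal Pi1 Pi2 Pi3 y | y in E'] :\ terminal Pi1 Pi2 Pi3 x =
      [set terminal Pi1 Pi2 Pi3 y | y in E' :\ x] by [].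
  apply/setP => v; rewrite in_setD1; apply/andP/imsetP.
    move=> [vx /imsetP[y yE' vy]]; exists y => //; rewrite in_setD1 yE' andbT.
    by apply: contra vx => /eqP yx; rewrite vy yx.
  move=> [y]; rewrite in_setD1 => /andP[yx yE'] ->; split; last exact: imset_f.
  by rewrite (inj_eq (@terminal_inj R n Pi1 Pi2 Pi3)).
Qed.

End FlowInequalities.

Theorem theorem3p9 (R : realType) (n : nat)
  (Pi1 Pi2 Pi3 : planar_network R n)
  (hPi1 : exists ps : seq (route Pi1), is_multipath n ps)
  (hPi2 : exists ps : seq (route Pi2), is_multipath n ps)
  (hPi3 : exists ps : seq (route Pi3), is_multipath n ps)
  (w1 : weighting R Pi1) (w2 : weighting R Pi2) (w3 : weighting R Pi3)
  (GZ1 : @multi_GZ R n (Single Pi1) w1)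
  (GZ2 : @multi_GZ R n (Single Pi2) w2)
  (GZ3 : @multi_GZ R n (Single Pi3) w3)
  (GZ12 : @multi_GZ R n (Then (Single Pi1) Pi2) (concat_weighting w1 w2))
  (GZ23 : @multi_GZ R n (Then (Single Pi2) Pi3) (concat_weighting w2 w3))
  (GZ123 : @multi_GZ R n (Then (Then (Single Pi1) Pi2) Pi3)
             (concat_weighting (concat_weighting w1 w2) w3)) :
  let m (i j k : nat) : \bar R :=
    @max_weight R n (Then (Then (Single Pi1) Pi2) Pi3)
      (concat_weighting (concat_weighting w1 w2) w3) [:: i; j; k] in
  forall i j k : nat, (i + j + k + 2 <= n)%N ->
    (m i j.+1 k + m i.+1 j k.+1 =
     maxe (m i.+1 j k + m i j.+1 k.+1) (m i j k.+1 + m i.+1 j.+1 k))%E.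
Proof.
move=> m i j k ijk; set w := concat_weighting _ w3 in m *.
have low F I a b c : a + b + c <= n ->
    flow3 F I (below n a) (below n b) (below n c) -> (\sum_(e in F) w e <= m a b c)%E.
  by move=> abc; apply: flow_max_weight; lia.
have high a b c l : a + b + c = l -> l <= n ->
    exists2 F, flow3 F (top n l) (below n a) (below n b) (below n c) & (\sum_(e in F) w e)%E = m a b c.
  by move=> <-; apply: multi_GZ_flow.
(* The exit [x] that changes sides is dictated by the trail and cannot be chosen. The new indices
   are therefore quantified after [x], and every possible [x] has to be treated. *)
have exch l a b c a' b' c' : (l < n)%N -> a + b + c = l -> a' + b' + c' = l.+1 ->
    let E := exits (below n a) (below n b) (below n c) in
    let E' := exits (below n a') (below n b') (below n c') in
    exists2 x, x \in E' :\: E & forall p q r p' q' r', p + q + r <= n -> p' + q' + r' <= n ->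
      x |: E = exits (below n p) (below n q) (below n r) ->
      E' :\ x = exits (below n p') (below n q') (below n r') ->
    (m a b c + m a' b' c' <= m p q r + m p' q' r')%E.
  move=> ln abc abc' E E'.
  have [F fl <-] := high a b c l abc (ltnW ln); have [F' fl' <-] := high a' b' c' l.+1 abc' ln.
  have [x [A [B [xE flA flB AB]]]] := flow3_exchange ln fl fl'.
  exists x => // p q r p' q' r' pqr pqr' Ep Ep'.
  rewrite -(sum_exchange w AB); apply: leeD.
    by apply: (low _ (top n l.+1)); rewrite // /flow3 -Ep.
  by apply: (low _ (top n l)); rewrite // /flow3 -Ep'.
have lattice : (m i j k.+1 + m i.+1 j.+1 k <= m i j.+1 k + m i.+1 j k.+1)%E.
  have [||F fl <-] := high i j k.+1 (i + j + k).+1; try lia.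
  have [||F' fl' <-] := high i.+1 j.+1 k (i + j + k).+2; try lia.
  have [A [B [flA flB AB]]] := flow3_lattice ijk fl fl'.
  by rewrite -(sum_exchange w AB); apply: leeD; [apply: low flA | apply: low flB]; lia.
apply: le_anti; rewrite ge_max lattice andbT; apply/andP; split.
(* X <= max(Y, Z): the exits of the larger flow that the other lacks are i at the first wall and k
   at the third. Moving the former gives Z, moving the latter gives Y. *)
- have [|||x /exits_diff xE le_x] := exch (i + j + k).+1 i j.+1 k i.+1 j k.+1; try lia.
  rewrite le_max; apply/orP; case: x xE le_x => [[x|x]|x] xE le_x; [right|lia|left].
    by rewrite [leRHS]addeC; apply: le_x; [lia|lia|apply: exitsU1|apply: exitsD1]; split=> //; lia.
  by rewrite [leRHS]addeC; apply: le_x; [lia|lia|apply: exitsU1|apply: exitsD1]; split=> //; lia.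
(* Y <= X: the exit is j at the second wall or k at the third. Moving the former gives Z, which
   [lattice] bounds by X; moving the latter gives X at once. *)
- have [|||x /exits_diff xE le_x] := exch (i + j + k).+1 i.+1 j k i j.+1 k.+1; try lia.
  case: x xE le_x => [[x|x]|x] xE le_x; [lia| |].
    apply: le_trans lattice; rewrite [leRHS]addeC.
    by apply: le_x; [lia|lia|apply: exitsU1|apply: exitsD1]; split=> //; lia.
  by rewrite [leRHS]addeC; apply: le_x; [lia|lia|apply: exitsU1|apply: exitsD1]; split=> //; lia.
Qed.
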